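(* Let $R$ be a Noetherian ring, $X=\mathrm{Spec}(R)$, and let $\mathcal{A}\subset\mathcal{B}$ be finitely generated standard graded $R$-algebras. Assume that each minimal prime of $\mathcal{B}$ contracts to a minimal prime of $R$. Then for each $n\geq 1$ $$\mathrm{Ass}_X(\mathcal{B}_n/\overline{\mathcal{A}_n})\subseteq\mathrm{Ass}_X(\mathcal{B}_{n+1}/\overline{\mathcal{A}_{n+1}}).$$ Moreover, for $n$ large enough $$\mathrm{Ass}_X(\mathcal{B}_n/\overline{\mathcal{A}_n})=\mathrm{Ass}_X(\mathcal{B}_{n+1}/\overline{\mathcal{A}_{n+1}}).$$
   Context: $\mathcal{A}_n$, $\mathcal{B}_n$ are the $n$th graded pieces, $\mathcal{A}_0=\mathcal{B}_0=R$; $\mathcal{A}\subset \mathcal{B}$ is an inclusion of graded $R$-algebras, and standard graded means generated over $R$ by the degree-one piece. $\overline{\mathcal{A}_n}$ is the integral closure of $\mathcal{A}_n$ in $\mathcal{B}_n$: the $R$-submodule of all $g\in\mathcal{B}_n$ satisfying in $\mathcal{B}$ an equation $g^u+a_1g^{u-1}+\cdots+a_u=0$ with $u\ge1$ and $a_i\in\mathcal{A}_{ni}$ (equivalently, the elements of $\mathcal{B}_n$ integral over $\mathcal{A}$). $\mathrm{Ass}_X(L)$ is the set of points of $X$ whose prime ideals are associated primes of the $R$-module $L$. *)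

(* Defs.v *)
From HB Require Import structures.
From mathcomp Require Import all_boot all_algebra.
From mathcomp Require Import boolp classical_sets.

Set Implicit Arguments.
Unset Strict Implicit.
Unset Printing Implicit Defensive.

Import GRing.Theory.
Local Open Scope ring_scope.
Local Open Scope quotient_scope.

(* [submodClosed V], [subalgClosed B] and [prime_idealr R] bundle bool-valued
   predicates; with the excluded middle of [boolp] these are all the
   submodules, subalgebras and prime ideals. *)

(** * Noetherian rings *)

Definition fin_gen (R : comNzRingType) (V : lmodType R) (M : submodClosed V) :=
  exists s : seq V, forall x : V,
    x \in M <-> exists c : nat -> R, x = \sum_(i < size s) c i *: s`_i.

Definition noetherian (R : comNzRingType) :=
  forall I : submodClosed R^o, fin_gen I.

(** * Prime ideals *)

Definition minimal_prime (R : comNzRingType) (P : prime_idealr R) :=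
  forall Q : prime_idealr R, {subset Q <= P} -> {subset P <= Q}.

Section Contraction.
Variables (R S : comNzRingType) (f : {rmorphism R -> S}) (P : prime_idealr S).

Definition contraction_pred : {pred R} := fun r => f r \in P.

Lemma contractionE r : (r \in contraction_pred) = (f r \in P).
Proof. by []. Qed.

Lemma contraction_idealr : idealr_closed contraction_pred.
Proof.
split; rewrite ?contractionE ?rmorph0 ?rmorph1 ?idealr0 ?idealr1 //.
by move=> a u v; rewrite !contractionE => uP vP; rewrite rmorphD rmorphM rpredD ?idealMr.
Qed.

Lemma contraction_prime : prime_idealr_closed contraction_pred.
Proof. by move=> u v; rewrite !contractionE rmorphM prime_idealrM. Qed.

HB.instance Definition _ := isIdealr.Build R contraction_pred contraction_idealr.
HB.instance Definition _ :=
  isPrimeIdealrClosed.Build R contraction_pred contraction_prime.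

Definition contraction : prime_idealr R := contraction_pred.
End Contraction.

(** * Associated primes, as points of Spec R *)

Definition Ass (R : comNzRingType) (L : lmodType R) : set (prime_idealr R) :=
  [set P | exists x : L, forall r : R, r \in P <-> r *: x = 0].

(** * Quotient modules *)

(* [quot_mod M N] is the quotient of [M] by [N], for submodules [N] and [M] of
   an ambient module with [N] contained in [M]; in general it is the quotient
   of [M] by the intersection of [M] and [N]. *)

Section Submodule.
Variables (R : comNzRingType) (V : lmodType R) (M : submodClosed V).

Definition submodule := {x : V | x \in M}.
HB.instance Definition _ := SubType.copy submodule {x : V | x \in M}.
HB.instance Definition _ := Choice.copy submodule {x : V | x \in M}.
HB.instance Definition _ := GRing.SubChoice_isSubLmodule.Build R V
  (mem M) submodule (GRing.subsemimodClosedP M).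

Variable N : submodClosed V.

Definition trace_in : {pred submodule} := fun x => val x \in N.

Lemma trace_inE x : (x \in trace_in) = (val x \in N).
Proof. by []. Qed.

Lemma trace_in_closed : subsemimod_closed trace_in.
Proof.
split; [split|] => [|x y|a x]; rewrite ?trace_inE ?raddf0 ?rpred0 //.
- by rewrite raddfD /=; apply: rpredD.
- by rewrite linearZ /=; apply: rpredZ.
Qed.

HB.instance Definition _ := GRing.isSubmodClosed.Build R submodule trace_in trace_in_closed.

Definition quot_mod := Quotient.quot trace_in.
HB.instance Definition _ := EqQuotient.on quot_mod.
HB.instance Definition _ := Choice.on quot_mod.
HB.instance Definition _ := GRing.Zmodule.on quot_mod.

Definition to_quot (x : submodule) : quot_mod := \pi_(Quotient.quot trace_in) x.

Lemma to_quotP x y : to_quot x = to_quot y <-> val x - val y \in N.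
Proof.
rewrite -[_ \in N]/(x - y \in trace_in) Quotient.idealrBE.
by split=> [/eqP|/eqP].
Qed.

Lemma to_quot_repr q : to_quot (repr q) = q.
Proof. exact: reprK. Qed.

Lemma to_quotD x y : to_quot (x + y) = to_quot x + to_quot y.
Proof. exact: Quotient.pi_add. Qed.

Definition quot_scale (a : R) (q : quot_mod) : quot_mod := to_quot (a *: repr q).

Lemma to_quotZ a x : to_quot (a *: x) = quot_scale a (to_quot x).
Proof.
apply/to_quotP; rewrite -[_ \in N]/(a *: x - a *: repr (to_quot x) \in trace_in).
by rewrite -scalerBr rpredZ //; apply/to_quotP; rewrite to_quot_repr.
Qed.

Lemma quot_scaleA a b q : quot_scale a (quot_scale b q) = quot_scale (a * b) q.
Proof. by rewrite -[q]to_quot_repr -!to_quotZ scalerA. Qed.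

Lemma quot_scale1 : left_id 1 quot_scale.
Proof. by move=> q; rewrite -[q]to_quot_repr -to_quotZ scale1r. Qed.

Lemma quot_scaleDr : right_distributive quot_scale +%R.
Proof.
move=> a p q; rewrite -[p]to_quot_repr -[q]to_quot_repr.
by rewrite -to_quotD -!to_quotZ -to_quotD scalerDr.
Qed.

Lemma quot_scaleDl q : {morph quot_scale^~ q : a b / a + b}.
Proof.
by move=> a b; rewrite -[q]to_quot_repr -!to_quotZ -to_quotD scalerDl.
Qed.

HB.instance Definition _ := GRing.Zmodule_isLmodule.Build R quot_mod
  quot_scaleA quot_scale1 quot_scaleDr quot_scaleDl.

Lemma to_quot_eq0 x : to_quot x = 0 <-> val x \in N.
Proof.
have -> : (0 : quot_mod) = to_quot 0 by apply: (addrI (to_quot 0)); rewrite -to_quotD !addr0.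
by rewrite to_quotP (_ : val (0 : submodule) = 0) // subr0.
Qed.

Lemma Ass_quot_mod P : Ass quot_mod P <->
  exists2 x, x \in M & forall r : R, r \in P <-> r *: x \in N.
Proof.
split=> [[q qP]|[x xM xP]].
  exists (val (repr q)) => [|r]; first exact: valP.
  rewrite qP -[q in _ *: q]to_quot_repr.
  have -> : r *: to_quot (repr q) = to_quot (r *: repr q) by rewrite to_quotZ.
  by rewrite to_quot_eq0 linearZ.
exists (to_quot (exist _ x xM)) => r.
have -> : r *: to_quot (exist _ x xM) = to_quot (r *: (exist _ x xM : submodule)).
  by rewrite to_quotZ.
by rewrite to_quot_eq0 linearZ xP.
Qed.
End Submodule.

(** * Graded algebras *)

(* [B] is the internal direct sum of its pieces, and the structure map
   identifies [R] with the piece of degree 0. *)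
Record grading (R : comNzRingType) (B : comAlgType R) := Grading {
  piece :> nat -> submodClosed B;
  piece_mul : forall i j x y,
    x \in piece i -> y \in piece j -> x * y \in piece (i + j)%N;
  piece_span : forall x, exists m (f : nat -> B),
    (forall i, f i \in piece i) /\ x = \sum_(i < m) f i;
  piece_indep : forall m (f : nat -> B), (forall i, f i \in piece i) ->
    \sum_(i < m) f i = 0 -> forall i, (i < m)%N -> f i = 0;
  piece0 : forall x, x \in piece 0%N <-> exists r : R, x = r%:A;
  in_alg_inj : injective (in_alg B)
}.

(* The piece of degree [n] of a graded subalgebra [A] is [A] intersected with
   the piece of degree [n] of [B]. *)
Record graded_subalg (R : comNzRingType) (B : comAlgType R) (G : grading B) :=
  GradedSubalg {
  subalg :> subalgClosed B;
  subalg_homogeneous : forall x, x \in subalg -> exists m (f : nat -> B),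
    (forall i, f i \in subalg /\ f i \in G i) /\ x = \sum_(i < m) f i
}.

Definition gen_subalg (R : comNzRingType) (B : comAlgType R) (S : set B) : set B :=
  [set x | forall T : subalgClosed B, (forall y, S y -> y \in T) -> x \in T].

Definition fin_gen_alg (R : comNzRingType) (B : comAlgType R) (A : set B) :=
  exists s : seq B, A = gen_subalg [set` s].

(** * Integral closure *)

Section IntegralClosure.
Variables (R : comNzRingType) (B : comAlgType R) (G : grading B).
Variables (A : graded_subalg G) (n : nat).

Definition integral_eqn (g : B) := exists (u : nat) (a : nat -> B),
  [/\ (0 < u)%N,
      forall i, (1 <= i <= u)%N -> a i \in (A : subalgClosed B) /\ a i \in G (n * i)%N
    & g ^+ u + \sum_(1 <= i < u.+1) a i * g ^+ (u - i) = 0].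

Definition int_closure : {pred B} := fun g => (g \in G n) && `[< integral_eqn g >].

(* Taking the component of degree [n * u] of a monic equation of degree [u]
   shows that [int_closure] consists of the elements of degree [n] integral over
   [A]; hence it is a submodule. *)
Definition subalg_ring := {x : B | x \in (A : subalgClosed B)}.

Lemma subalg_subring : subring_closed (A : subalgClosed B).
Proof.
split=> [|x y xA yA|x y]; first exact: rpred1.
  by rewrite rpredD // -scaleN1r rpredZ.
exact: rpredM.
Qed.

HB.instance Definition _ := SubType.copy subalg_ring {x : B | x \in (A : subalgClosed B)}.
HB.instance Definition _ := Choice.copy subalg_ring {x : B | x \in (A : subalgClosed B)}.
HB.instance Definition _ := GRing.SubChoice_isSubComNzRing.Build B
  (mem (A : subalgClosed B)) subalg_ring subalg_subring.

Let iota : {rmorphism subalg_ring -> B} := val.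

Lemma integral_eqn_over g : integral_eqn g -> integralOver iota g.
Proof.
move=> [u [a [u0 aA eq0]]].
pose c j : subalg_ring := insubd 0 (a (u - j)%N).
pose q := \poly_(j < u) c j.
have szq : (size q < u.+1)%N by rewrite ltnS size_poly.
have szp : size ('X^u + q) = u.+1 by rewrite size_polyDl size_polyXn.
exists ('X^u + q); first by rewrite monicE lead_coefDl ?size_polyXn // lead_coefXn.
rewrite /root (@horner_coef_wide _ u.+1); last by rewrite -szp size_poly.
rewrite big_ord_recr /= coef_map_id0 ?rmorph0 // coefD coefXn eqxx.
have -> : q`_u = 0 by rewrite coef_poly ltnn.
rewrite addr0 rmorph1 mul1r addrC; apply/eqP.
rewrite -[RHS]eq0; congr (_ + _).
rewrite big_add1 /= big_nat_rev /= big_mkord add0n.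
apply: eq_bigr => j _.
rewrite coef_map_id0 ?rmorph0 // coefD coefXn ltn_eqF // add0r coef_poly ltn_ord.
rewrite subnSK // subKn 1?ltnW //; congr (_ * _).
rewrite /c insubdK //; apply: (aA _ _).1.
by rewrite subn_gt0 ltn_ord leq_subr.
Qed.

Lemma subalg_decomp x : x \in (A : subalgClosed B) -> exists f : nat -> B,
  (forall i, f i \in (A : subalgClosed B) /\ f i \in G i) /\
  exists m, forall k, (m <= k)%N -> x = \sum_(i < k) f i.
Proof.
move=> /(subalg_homogeneous)[m [f [fP ->]]].
exists (fun i => if (i < m)%N then f i else 0); split.
  by move=> i; case: ifP => // _; rewrite !rpred0.
exists m => k mk.
rewrite -!(big_mkord xpredT (fun i => if (i < m)%N then f i else 0)).
rewrite (big_cat_nat (leq0n _) mk) //= [X in _ = _ + X]big_nat_cond [X in _ = _ + X]big1 ?addr0.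
  by rewrite big_mkord; apply: eq_bigr => i _; rewrite ltn_ord.
by move=> i /andP[/andP[mi _] _]; rewrite ltnNge mi.
Qed.

Lemma grading1 : 1 \in G 0%N.
Proof. by apply/piece0; exists 1; rewrite scale1r. Qed.

Lemma gradingX g j : g \in G n -> g ^+ j \in G (n * j)%N.
Proof.
move=> gG; elim: j => [|j IH]; first by rewrite muln0 expr0 grading1.
by rewrite mulnS exprS; apply: piece_mul.
Qed.

Lemma integral_over_eqn g : g \in G n -> integralOver iota g -> integral_eqn g.
Proof.
move=> gG [p pmon /rootP proot].
pose d := (size p).-1.
have szp : size p = d.+1 by rewrite /d prednK // size_poly_gt0 monic_neq0.
have coefA j : exists fm : (nat -> B) * nat,
    [/\ forall i, fm.1 i \in (A : subalgClosed B) /\ fm.1 i \in G i,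
        forall k, (fm.2 <= k)%N -> iota p`_j = \sum_(i < k) fm.1 i
      & j = d -> fm.1 0%N = 1].
  have [jd|jd] := eqVneq j d; last first.
    have [f [fA [m fm]]] := subalg_decomp (valP p`_j).
    by exists (f, m); split=> // /eqP; rewrite (negPf jd).
  exists (fun i => if i == 0%N then 1 else 0, 1%N); split=> // [i|k k0] /=.
    by case: eqP => [->|_]; rewrite ?rpred0 ?rpred1 ?grading1.
  have -> : p`_j = 1 by rewrite jd -[RHS](monicP pmon) lead_coefE.
  move: k0; case: k => [|k] //= _; rewrite big_ord_recl big1 ?addr0 //=.
have [F0 FP] := choice coefA.
pose F j := (F0 j).1; pose M := \max_(j < d.+1) (F0 j).2.
pose H k := \sum_(j < d.+1) (if (n * j <= k)%N then F j (k - n * j)%N else 0) * g ^+ j.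
have HG k : H k \in G k.
  apply: rpred_sum => j _; case: leqP => jk; last by rewrite mul0r rpred0.
  rewrite -{2}(subnK jk); apply: piece_mul; last exact: gradingX.
  by have [/(_ (k - n * j)%N)[]] := FP j.
pose K := (M + n * d).+1.
have sumH : \sum_(k < K) H k = 0.
  rewrite -[RHS]proot (@horner_coef_wide _ d.+1); last by rewrite -szp size_poly.
  rewrite exchange_big /=; apply: eq_bigr => j _.
  rewrite -mulr_suml coef_map_id0 ?rmorph0 //; congr (_ * _).
  have jd : (n * j <= n * d)%N by rewrite leq_mul2l -ltnS ltn_ord orbT.
  have jK : (n * j <= K)%N by rewrite (leq_trans jd) // /K -addSn leq_addl.
  have [_ F0E _] := FP j; rewrite -[RHS]/(iota p`_j) (F0E (K - n * j)%N); last first.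
    have jM : ((F0 j).2 <= M)%N by apply: (leq_bigmax j).
    by rewrite leq_subRL // addnC (leq_trans (leq_add jM jd)).
  rewrite -(big_mkord xpredT (fun k => if (n * j <= k)%N then F j (k - n * j)%N else 0)).
  rewrite (big_cat_nat (leq0n _) jK) //= big_nat_cond big1 ?add0r; last first.
    by move=> i /andP[/andP[_ ij] _]; rewrite leqNgt ij.
  rewrite -{1}[(n * j)%N]add0n big_addn big_mkord.
  by apply: eq_bigr => i _; rewrite leq_addl addnK.
have Hd : H (n * d)%N = 0.
  by apply: (piece_indep HG sumH); rewrite ltnS leq_addl.
have d_gt0 : (0 < d)%N.
  rewrite lt0n; apply/eqP => d0; move: Hd; rewrite /H d0 big_ord1 muln0 /=.
  have [_ _ /(_ (esym d0))] := FP 0%N; rewrite /F => -> /eqP.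
  by rewrite mul1r expr0 oner_eq0.
exists d, (fun i => F (d - i)%N (n * i)%N); split=> //.
  by move=> i _; have [/(_ (n * i)%N)] := FP (d - i)%N.
rewrite -[RHS]Hd /H big_ord_recr /= leqnn subnn.
have [_ _ /(_ erefl)] := FP d; rewrite -/(F d) => ->; rewrite mul1r addrC.
congr (_ + _); rewrite big_add1 /= big_nat_rev /= big_mkord add0n.
apply: eq_bigr => j _.
have jd := ltn_ord j.
have -> : (d - (d - j.+1).+1 = j)%N by rewrite subnSK // subKn // ltnW.
by rewrite subnSK // leq_mul2l (ltnW jd) orbT mulnBr.
Qed.

Lemma int_closure_closed : subsemimod_closed int_closure.
Proof.
have clE g : (g \in int_closure) <-> (g \in G n /\ integralOver iota g).
  split=> [/andP[gG /asboolP/integral_eqn_over] //|[gG /integral_over_eqn gI]].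
  by apply/andP; split=> //; apply/asboolP/gI.
split; [split|].
- by apply/clE; split; [exact: rpred0 | exact: integral0].
- move=> x y /clE[xG xI] /clE[yG yI]; apply/clE; split; first exact: rpredD.
  exact: integral_add.
- move=> a x /clE[xG xI]; apply/clE; split; first exact: rpredZ.
  rewrite -mulr_algl; apply: integral_mul => //.
  have aA : a%:A \in (A : subalgClosed B) by rewrite rpredZ ?rpred1.
  have -> : a%:A = iota (exist _ a%:A aA) by [].
  exact: integral_id.
Qed.

HB.instance Definition _ :=
  GRing.isSubmodClosed.Build R B int_closure int_closure_closed.
End IntegralClosure.

(* Main.v *)
Require Import Defs.
From HB Require Import structures.
From mathcomp Require Import all_boot all_algebra.
From mathcomp Require Import boolp classical_sets.
Import GRing.Theory.
Local Open Scope ring_scope.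
Local Open Scope classical_set_scope.

Set Implicit Arguments.
Unset Strict Implicit.
Unset Printing Implicit Defensive.

(* Write [C_n] for the integral closure of [A_n] in [B_n].

   Inclusion: let [P = (C_n : x)].  If [P] contains [(C_n.+1 : x g)] for some
   [g] in [A_1], the two are equal.  Otherwise, after multiplying [x] by a
   scalar outside [P], [x A_1] is contained in [C_n.+1].  As [x] is not integral
   over [A], some minimal prime [Q] of [B] avoids all values [p(x)], [p] monic
   over [A].  If [Q] does not contain [A_1], the powers of [x] times a suitable
   [g ^ e], [g] in [A_1] outside [Q], stay in a finite [A]-module, and a monic
   [p(x)] lies in [Q]: contradiction.  If [Q] contains [A_1], then every [C_m],
   [m > 0], lies in [Q], so [P] is contained in, hence equal to, the minimal prime
   of [R] below [Q]; for [b] in [B_1] outside [Q] the annihilator of [x b] in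
   [B_n.+1 / C_n.+1] lies in [P], and [P] is minimal over it.

   Stability: let [I = A_1 B].  The ring [gr_I B] is Noetherian, so finitely many
   primes of [R] are associated to it.  If [P = (C_n : x)] were not one of them,
   then, since [P] is nilpotent on [x ^ k] modulo [I ^ (n (k - U))] for a fixed
   [U], there would be [s_k] outside [P] with [s_k x ^ k] in [I ^ (n (k - U))].
   A linear relation between these elements in the Rees ring of [I] makes
   [s x] integral over [A] for some [s] outside [P]. *)

(** * Generation and minimal primes *)

(** By excluded middle, the closed set [T] becomes a bundled [subalgClosed], hence one of the
    subalgebras over which [gen_subalg] intersects. *)
Lemma gen_subalg_ind (R : comNzRingType) (B : comAlgType R) (S T : set B) :
    T 1 -> (forall (a : R) u v, T u -> T v -> T (a *: u + v)) ->
    (forall u v, T u -> T v -> T (u * v)) -> S `<=` T ->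
  gen_subalg S `<=` T.
Proof.
move=> T1 TZ TM ST x Sx.
pose p : {pred B} := fun y => `[< T y >].
have pE y : reflect (T y) (y \in p) by exact: asboolP.
have pP : GRing.subalg_closed p.
  by split=> [|a u v /pE Tu /pE Tv|u v /pE Tu /pE Tv]; apply/pE; auto.
pose K := GRing.isSubalgClosed.Build R B p pP.
pose pS : subalgClosed B := HB.pack p K.
by apply/pE; apply: (Sx pS) => y /ST Ty; apply/pE.
Qed.

Lemma gen_subalg_sub (R : comNzRingType) (B : comAlgType R) (S : set B) :
  S `<=` gen_subalg S.
Proof. by move=> x Sx T; exact. Qed.

Lemma gen_subalgM (R : comNzRingType) (B : comAlgType R) (S : set B) x y :
  gen_subalg S x -> gen_subalg S y -> gen_subalg S (x * y).
Proof. by move=> Sx Sy T ST; rewrite rpredM ?Sx ?Sy. Qed.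

Lemma gen_subalg_lin (R : comNzRingType) (B : comAlgType R) (S : set B) (a : R) x y :
  gen_subalg S x -> gen_subalg S y -> gen_subalg S (a *: x + y).
Proof. by move=> Sx Sy T ST; rewrite rpredD ?rpredZ ?Sx ?Sy. Qed.

Lemma gen_subalg1 (R : comNzRingType) (B : comAlgType R) (S : set B) :
  gen_subalg S 1.
Proof. by move=> T ST; rewrite rpred1. Qed.

Lemma gen_subalg_mono (R : comNzRingType) (B : comAlgType R) (S T : set B) :
  S `<=` gen_subalg T -> gen_subalg S `<=` gen_subalg T.
Proof.
move=> ST; apply: gen_subalg_ind => //.
- exact: gen_subalg1.
- exact: gen_subalg_lin.
- exact: gen_subalgM.
Qed.

Lemma gen_subalg_finite (R : comNzRingType) (B : comAlgType R) (S : set B) x :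
  gen_subalg S x ->
  exists2 s : seq B, [set` s] `<=` S & gen_subalg [set` s] x.
Proof.
apply: (@gen_subalg_ind _ _ _
    [set x | exists2 s : seq B, [set` s] `<=` S & gen_subalg [set` s] x])
  => [|a u v|u v|y Sy] /=.
- by exists [::] => //; exact: gen_subalg1.
- move=> [s sS su] [t tS tv]; exists (s ++ t).
    by move=> y /=; rewrite mem_cat => /orP[/sS|/tS].
  apply: gen_subalg_lin; [move: su|move: tv]; apply: gen_subalg_mono => y sy;
    by apply: gen_subalg_sub; rewrite /= mem_cat sy ?orbT.
- move=> [s sS su] [t tS tv]; exists (s ++ t).
    by move=> y /=; rewrite mem_cat => /orP[/sS|/tS].
  apply: gen_subalgM; [move: su|move: tv]; apply: gen_subalg_mono => y sy;
    by apply: gen_subalg_sub; rewrite /= mem_cat sy ?orbT.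
- exists [:: y] => [z /=|]; first by rewrite inE => /eqP ->.
  by apply: gen_subalg_sub; rewrite /= inE.
Qed.

(** Each of the finitely many given generators of [A] involves only finitely many elements of [S].
    This is what later provides finitely many generators of degree one. *)
Lemma fin_gen_alg_sub (R : comNzRingType) (B : comAlgType R) (A S : set B) :
    fin_gen_alg A -> gen_subalg S = A ->
  exists2 s : seq B, [set` s] `<=` S & gen_subalg [set` s] = A.
Proof.
move=> [t ->] genS.
have [s sS ts] : exists2 s : seq B, [set` s] `<=` S & [set` t] `<=` gen_subalg [set` s].
  have : [set` t] `<=` gen_subalg S by rewrite genS; exact: gen_subalg_sub.
  elim: t {genS} => [|y t IH] tS; first by exists [::] => //.
  have [z tz|s sS ts] := IH; first by apply: tS; rewrite /= inE tz orbT.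
  have [|s' s'S ys'] := @gen_subalg_finite _ _ S y; first by apply: tS; rewrite /= mem_head.
  exists (s' ++ s) => [z|z] /=; first by rewrite mem_cat => /orP[/s'S|/sS].
  rewrite inE => /orP[/eqP ->|/ts].
    by move: ys'; apply: gen_subalg_mono => w sw; apply: gen_subalg_sub; rewrite /= mem_cat sw.
  by apply: gen_subalg_mono => w sw; apply: gen_subalg_sub; rewrite /= mem_cat sw orbT.
exists s => //; apply/seteqP; split; last exact: gen_subalg_mono.
rewrite -genS; apply: gen_subalg_mono; exact: subset_trans (@gen_subalg_sub _ _ _).
Qed.

Definition mult_set (R : comNzRingType) (S : set R) :=
  S 1 /\ forall x y, S x -> S y -> S (x * y).

Lemma prime_ideal_of (R : comNzRingType) (I : set R) :
    I 0 -> ~ I 1 -> (forall a u v, I u -> I v -> I (a * u + v)) ->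
    (forall u v, I (u * v) -> I u \/ I v) ->
  exists P : prime_idealr R, forall x, x \in P <-> I x.
Proof.
move=> I0 I1 IZ IM.
pose p : {pred R} := fun y => `[< I y >].
have pE y : reflect (I y) (y \in p) by exact: asboolP.
have pP : idealr_closed p.
  split=> [||a u v /pE Iu /pE Iv]; first exact/pE.
  - by apply/negP => /pE.
  - exact/pE/IZ.
have pQ : prime_idealr_closed p.
  by move=> u v /pE/IM[] Iu; apply/orP; [left|right]; exact/pE.
pose K := isIdealr.Build R p pP.
pose K' := isPrimeIdealrClosed.Build R p pQ.
pose pS : prime_idealr R := HB.pack p K K'.
by exists pS => x; split=> /pE.
Qed.

(** Every monomial of degree [k + l] in [x] and [y] is divisible by [x ^+ k] or by [y ^+ l]. *)
Lemma exprD_split (R : comNzRingType) (x y : R) k l :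
  exists c d, (x + y) ^+ (k + l) = c * x ^+ k + d * y ^+ l.
Proof.
elim: k l => [|k IHk] l; first by exists ((x + y) ^+ l), 0; rewrite mulr1 mul0r addr0.
elim: l => [|l IHl].
  by exists 0, ((x + y) ^+ (k.+1 + 0)); rewrite mul0r add0r mulr1.
have [c [d E1]] := IHk l.+1; have [c' [d' E2]] := IHl.
exists (c + y * c'), (x * d + d'); rewrite addSn exprS mulrDl {1}E1.
rewrite -addSnnS E2 !exprS !mulrDr !mulrDl !mulrA addrACA.
by rewrite (mulrC x c) (mulrC (y * c') x) !mulrA (mulrC x y) (mulrC y d') (mulrC _ y).
Qed.

Lemma prime_idealX (R : comNzRingType) (P : prime_idealr R) x k :
  x ^+ k \in P -> x \in P.
Proof.
by elim: k => [|k IH]; rewrite ?expr0 ?idealr1 // exprS prime_idealrM => /orP[].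
Qed.

(* The complement of a maximal multiplicative set avoiding [0] is a minimal
   prime. *)
Lemma exists_minimal_prime (R : comNzRingType) (S : set R) :
    mult_set S -> ~ S 0 ->
  exists2 P : prime_idealr R, minimal_prime P & forall x, x \in P -> ~ S x.
Proof.
move=> [S1 SM] S0.
(* Zorn's lemma ranges over the sets [U] to be added to [S], rather than over sets containing [S],
   so that the empty chain needs no separate treatment. *)
pose good (U : set R) := mult_set (S `|` U) /\ ~ (S `|` U) 0.
have [F Fgood Ftot|U0 [[U0m U00] U0max]] := @Zorn_bigcup _ good.
  split; first split; first by left.
    move=> x y [Sx|[X FX Xx]] [Sy|[Y FY Yy]].
    - by left; apply: SM.
    - have [[_ M] _] := Fgood _ FY.
      by have [|Mxy] := M x y (or_introl Sx) (or_intror Yy); [left|right; exists Y].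
    - have [[_ M] _] := Fgood _ FX.
      by have [|Mxy] := M x y (or_intror Xx) (or_introl Sy); [left|right; exists X].
    - have [XY|YX] := Ftot _ _ FX FY.
        have [[_ M] _] := Fgood _ FY.
        by have [|Mxy] := M x y (or_intror (XY _ Xx)) (or_intror Yy); [left|right; exists Y].
      have [[_ M] _] := Fgood _ FX.
      by have [|Mxy] := M x y (or_intror Xx) (or_intror (YX _ Yy)); [left|right; exists X].
  by case=> [//|[X /Fgood[_ nX0] X0]]; apply: nX0; right.
pose U := S `|` U0.
have [U1 UM] : mult_set U by [].
have UX u k : U u -> U (u ^+ k).
  by move=> Uu; elim: k => [|k IH]; rewrite ?expr0 // exprS; apply: UM.
(* By maximality, the multiplicative set generated by [U] and an outside element [y] contains
   [0]. *)
have nU y : ~ U y -> exists2 u, U u & exists k, u * y ^+ k = 0.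
  move=> nUy; apply: contrapT => noU.
  pose V : set R := [set z | exists2 u, U u & exists k, z = u * y ^+ k].
  have UV : U `<=` V by move=> u Uu; exists u => //; exists 0%N; rewrite expr0 mulr1.
  apply: (U0max V).
    split=> [u U0u|VU0]; first by apply: UV; right.
    by apply: nUy; right; apply: VU0; exists 1 => //; exists 1%N; rewrite mul1r.
  have SV : S `|` V = V.
    by apply/seteqP; split=> z; [case=> // Sz; apply: UV; left|right].
  split; rewrite SV; last by move=> [u Uu [k uk]]; apply: noU; exists u => //; exists k.
  split; first exact: UV.
  move=> _ _ [u Uu [k ->]] [v Uv [l ->]]; exists (u * v); first exact: UM.
  by exists (k + l)%N; rewrite mulrACA exprD.
have nUI y : (exists2 u, U u & exists k, u * y ^+ k = 0) -> ~ U y.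
  by move=> [u Uu [k uk]] Uy; apply: U00; rewrite -/U -uk; apply: UM => //; apply: UX.
have [||a u v||P PE] := @prime_ideal_of R (~` U).
- exact: U00.
- by apply.
- move=> /nU[w Uw [k wk]] /nU[z Uz [l zl]].
  apply: nUI; exists (w * z); first exact: UM.
  have [c [d E]] := exprD_split (a * u) v k l.
  exists (k + l)%N; rewrite E exprMn mulrDr.
  transitivity (z * c * a ^+ k * (w * u ^+ k) + w * d * (z * v ^+ l)).
    by rewrite !mulrA; congr (_ + _);
      [rewrite [LHS](ACl (2*3*4*1*5))|rewrite [LHS](ACl (1*3*2*4))].
  by rewrite wk zl !mulr0 addr0.
- move=> u v nUuv; case: (pselect (U u)) => Uu; last by left.
  by right=> Uv; apply: nUuv; apply: UM.
(* Minimality: for [x] in [P] some [u * x ^+ k] vanishes, hence lies in [Q], while [u] is outside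
   [P] and so outside [Q]. *)
exists P => [Q QP x /PE/nU[u Uu [k uk]]|x /PE nUx Sx]; last by apply: nUx; left.
have : u * x ^+ k \in Q by rewrite uk idealr0.
rewrite prime_idealrM => /orP[/QP/PE //|]; exact: prime_idealX.
Qed.

(** * Noetherian modules *)

(* Subrings and the modules over them are all subsets of one ambient ring [E],
   so that adjoining an element changes a set and not a type. *)
Section Noetherian.
Variable E : comNzRingType.
Implicit Types (C M N S T : set E) (x y z v : E).

Definition is_subring C :=
  [/\ C 1, C (-1), forall x y, C x -> C y -> C (x + y)
    & forall x y, C x -> C y -> C (x * y)].

Definition is_submod C M :=
  [/\ M 0, forall x y, M x -> M y -> M (x + y) & forall c x, C c -> M x -> M (c * x)].

Inductive lspan C S : set E :=
| span0 : lspan C S 0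
| spanD c y z : C c -> S y -> lspan C S z -> lspan C S (c * y + z).

Definition noeth C M := forall N, is_submod C N -> N `<=` M ->
  exists2 s : seq E, [set` s] `<=` N & N `<=` lspan C [set` s].

Lemma subring0 C : is_subring C -> C 0.
Proof. by move=> [C1 CN CD _]; rewrite -(subrr 1); exact: CD. Qed.

Lemma subringN C x : is_subring C -> C x -> C (- x).
Proof. by move=> [_ CN _ CM] Cx; rewrite -mulN1r; exact: CM. Qed.

Lemma subring_submod C : is_subring C -> is_submod C C.
Proof. by move=> Cr; have C0 := subring0 Cr; case: Cr. Qed.

Lemma submod_sum C M : is_submod C M ->
  forall (I : Type) (r : seq I) (P : pred I) (F : I -> E),
    (forall i, P i -> M (F i)) -> M (\sum_(i <- r | P i) F i).
Proof. by move=> [M0 MD _] I r P F; apply: big_ind. Qed.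

Lemma submodN C M x : is_subring C -> is_submod C M -> M x -> M (- x).
Proof. by move=> [_ CN _ _] [_ _ MM] Mx; rewrite -mulN1r; exact: MM. Qed.

Lemma submodB C M x y : is_subring C -> is_submod C M -> M x -> M y -> M (x - y).
Proof.
by move=> Cr Mm Mx My; have [_ MD _] := Mm; apply: MD => //; apply: submodN Cr Mm My.
Qed.

Lemma submodI C M N : is_submod C M -> is_submod C N -> is_submod C (M `&` N).
Proof.
move=> [M0 MD MM] [N0 ND NM].
by split=> // [x y [? ?] [? ?]|c x Cc [? ?]]; split; auto.
Qed.

Lemma span_in C S y : is_subring C -> S y -> lspan C S y.
Proof.
by move=> [C1 _ _ _] Sy; rewrite -[y]mul1r -[_ * _]addr0; apply: spanD => //; exact: span0.
Qed.

Lemma span_submod C S : is_subring C -> is_submod C (lspan C S).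
Proof.
move=> [_ _ _ CM]; split; first exact: span0.
  move=> x y; elim=> [|c u z Cc Su _ IH] Sy; first by rewrite add0r.
  by rewrite -addrA; apply: spanD => //; exact: IH.
move=> c x Cc; elim=> [|d u z Cd Su _ IH]; first by rewrite mulr0; exact: span0.
by rewrite mulrDr mulrA; apply: spanD => //; exact: CM.
Qed.

Lemma span_min C S M : is_submod C M -> S `<=` M -> lspan C S `<=` M.
Proof.
move=> [M0 MD MM] SM x; elim=> // c y z Cc Sy _.
by apply: MD; apply: MM => //; exact: SM.
Qed.

Lemma span_mono C S T : is_subring C -> S `<=` T -> lspan C S `<=` lspan C T.
Proof. by move=> Cr ST; apply: span_min; [exact: span_submod|move=> y /ST; exact: span_in]. Qed.

Lemma span_family C (y : nat -> E) K x :
    is_subring C -> lspan C (y @` `I_K) x ->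
  exists2 f : nat -> E, forall i, C (f i) & x = \sum_(i < K) f i * y i.
Proof.
move=> Cr; elim=> [|c _ z Cc [i iK <-] _ [f Cf ->]].
  exists (fun=> 0) => [i|]; first exact: subring0.
  by rewrite big1 // => i _; rewrite mul0r.
exists (fun j => f j + (if j == i then c else 0)) => [j|].
  by have [_ _ CD _] := Cr; apply: CD => //; case: ifP => // _; exact: subring0.
under [RHS]eq_bigr do rewrite mulrDl.
rewrite big_split /= addrC; congr (_ + _).
rewrite (bigD1 (Ordinal iK)) //= eqxx big1 ?addr0 // => j ji.
by case: eqP => [E'|_]; rewrite ?mul0r //; case/eqP: ji; apply: val_inj.
Qed.

Lemma noeth_sub C M N : N `<=` M -> noeth C M -> noeth C N.
Proof. by move=> NM nM L Lm LN; apply: nM => //; exact: subset_trans NM. Qed.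

(** The span of the whole sequence has finitely many generators, which involve only finitely many
    terms; the next term depends on these. This yields the relations of [ideal_integral_dep] and
    [rees_dep]. *)
Lemma noeth_dep C M (y : nat -> E) :
    is_subring C -> is_submod C M -> noeth C M -> (forall i, M (y i)) ->
  exists K, lspan C (y @` `I_K) (y K).
Proof.
move=> Cr Mm nM My.
have [|s sN Ns] := nM _ (span_submod (range y) Cr).
  by apply: span_min => // _ [i _ <-].
have [K sK] : exists K, [set` s] `<=` lspan C (y @` `I_K).
  have {Ns} : forall x, x \in s -> exists K, lspan C (y @` `I_K) x.
    move=> x /sN; elim=> [|c _ z Cc [i _ <-] _ [K zK]]; first by exists 0%N; exact: span0.
    exists (maxn i.+1 K); apply: spanD => //.
      by exists i => //=; rewrite leq_max ltnS leqnn.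
    move: zK; apply: span_mono => // _ [j jK <-]; exists j => //=.
    by rewrite leq_max; apply/orP; right.
  elim: s {sN} => [|x s IH] sK; first by exists 0%N.
  have [z zs|K1 IH1] := IH; first by apply: sK; rewrite inE zs orbT.
  have [K2 xK2] := sK x (mem_head _ _).
  have le2 i j : (i <= j)%N -> lspan C (y @` `I_i) `<=` lspan C (y @` `I_j).
    by move=> ij; apply: span_mono => // _ [k ki <-]; exists k => //=; exact: leq_trans ij.
  exists (maxn K1 K2) => z /=; rewrite inE => /orP[/eqP ->|zs].
    exact: le2 (leq_maxr _ _) _ xK2.
  exact: le2 (leq_maxl _ _) _ (IH1 _ zs).
exists K; have : lspan C [set` s] (y K) by apply: Ns; apply: span_in => //; exists K.
by apply: span_min => //; exact: span_submod.
Qed.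

(** Otherwise choice builds a strictly increasing sequence in [F]; picking a new element at each
    stage contradicts [noeth_dep]. *)
Lemma noeth_max C M (F : set (set E)) (N0 : set E) :
    is_subring C -> is_submod C M -> noeth C M -> F N0 ->
    (forall N, F N -> is_submod C N /\ N `<=` M) ->
  exists2 N, F N & forall N', F N' -> N `<=` N' -> N' `<=` N.
Proof.
move=> Cr Mm nM F0 FM; apply: contrapT => noN.
have step (N : {N | F N}) : exists N' : {N | F N},
    sval N `<=` sval N' /\ exists2 y, sval N' y & ~ sval N y.
  apply: contrapT => noN'; apply: noN; exists (sval N); first exact: (svalP N).
  move=> N' FN' NN' y N'y; apply: contrapT => nNy; apply: noN'.
  by exists (exist _ N' FN'); split=> //; exists y.
have [f fP] := choice step.
pose G k := sval (iter k f (exist _ N0 F0)).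
have GS k : G k `<=` G k.+1 by have [] := fP (iter k f (exist _ N0 F0)).
have Gy k : exists y, G k.+1 y /\ ~ G k y.
  by have [_ [y]] := fP (iter k f (exist _ N0 F0)); exists y.
have Gm k : is_submod C (G k) /\ G k `<=` M by apply: FM; exact: (svalP (iter k f _)).
have [y yP] := choice Gy.
have [i|K yK] := @noeth_dep C M y Cr Mm nM; first by apply: (Gm i.+1).2; apply: (yP i).1.
apply: (yP K).2; move: yK; apply: span_min; first exact: (Gm K).1.
have mono i j : (i <= j)%N -> G i `<=` G j.
  elim: j => [|j IH]; first by rewrite leqn0 => /eqP ->.
  by rewrite leq_eqVlt => /orP[/eqP -> //|/IH ij]; exact: subset_trans (GS j).
by move=> _ [i iK <-]; apply: mono iK _ (yP i).1.
Qed.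

(** The coefficients of [v] in elements of [N] form an ideal [I] of [C]. Lifts to [N] of generators
    of [I], together with generators of the intersection of [N] and [M], generate [N]. *)
Lemma noeth_add C M v :
    is_subring C -> is_submod C M -> noeth C C -> noeth C M ->
  noeth C [set x | exists m c, [/\ M m, C c & x = m + c * v]].
Proof.
move=> Cr Mm nC nM N Nm NM.
have [C1 CN CD CM] := Cr; have C0 := subring0 Cr.
have [M0 MD MM] := Mm; have [N0 ND NN] := Nm.
pose I : set E := [set c | C c /\ exists2 m, M m & N (m + c * v)].
have Im : is_submod C I.
  split.
  - by split=> //; exists 0 => //; rewrite mul0r addr0.
  - move=> c d [Cc [m Mc Nc]] [Cd [m' Md Nd]]; split; first exact: CD.
    by exists (m + m'); [exact: MD|rewrite mulrDl addrACA; exact: ND].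
  - move=> c d Cc [Cd [m Md Nd]]; split; first exact: CM.
    by exists (c * m); [exact: MM|rewrite -mulrA -mulrDr; exact: NN].
have [s sI Is] : exists2 s : seq E, [set` s] `<=` I & I `<=` lspan C [set` s].
  by apply: nC => // c [].
have [t tNM NMt] : exists2 t : seq E, [set` t] `<=` N `&` M & N `&` M `<=` lspan C [set` t].
  by apply: nM (submodI Nm Mm) _ => x [].
have [g gP] : exists g : E -> E, forall c, c \in s -> M (g c) /\ N (g c + c * v).
  have : forall c, exists m, c \in s -> M m /\ N (m + c * v).
    by move=> c; case: (boolP (c \in s)) => [/sI[_ [m]]|]; [exists m|exists 0].
  by move=> /choice[g gP]; exists g.
pose T := t ++ [seq g c + c * v | c <- s].
exists T => [x|x Nx].
  by rewrite /= mem_cat => /orP[/tNM[]//|/mapP[c /gP[_ ?] ->]].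
have Tm := span_submod [set` T] Cr; have [_ TD TM] := Tm.
have sT c : lspan C [set` s] c ->
    exists m, [/\ M m, N (m + c * v) & lspan C [set` T] (m + c * v)].
  elim=> [|d e z Cd se _ [m [Mz Nz Tz]]].
    by exists 0; rewrite mul0r addr0; split=> //; exact: span0.
  have [Me Ne] := gP _ se.
  have E' : d * g e + m + (d * e + z) * v = d * (g e + e * v) + (m + z * v).
    by rewrite mulrDl mulrDr mulrA addrACA.
  exists (d * g e + m); split; rewrite ?E'; auto.
  apply: TD => //; apply: TM => //; apply: span_in => //=.
  by rewrite mem_cat; apply/orP; right; apply/mapP; exists e.
have [m [c [Mm' Cc xE]]] := NM _ Nx.
have [|m' [Mm'' Nm' Tm']] := sT c; first by apply: Is; split=> //; exists m; rewrite -?xE.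
rewrite -(subrK (m' + c * v) x); apply: TD => //.
have : lspan C [set` t] (x - (m' + c * v)).
  apply: NMt; split; first exact: (submodB Cr Nm).
  by rewrite xE opprD addrACA subrr addr0; exact: (submodB Cr Mm).
by apply: span_mono => // y; rewrite /= mem_cat => ->.
Qed.

(** * Hilbert's basis theorem *)

Definition poly_vals C d z : set E :=
  [set x | exists F : {poly E}, [/\ forall i, C F`_i, (size F <= d)%N & x = F.[z]]].

Definition adjoin C z : set E :=
  [set x | exists2 F : {poly E}, forall i, C F`_i & x = F.[z]].

Lemma poly_valsS C d z x : is_subring C -> poly_vals C d.+1 z x ->
  exists m c, [/\ poly_vals C d z m, C c & x = m + c * z ^+ d].
Proof.
move=> Cr [F [FC sF ->]]; have C0 := subring0 Cr.
exists (\poly_(i < d) F`_i).[z], F`_d; split=> //.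
  exists (\poly_(i < d) F`_i); split=> // i.
  by rewrite coef_poly; case: ifP.
by rewrite (horner_coef_wide _ sF) big_ord_recr horner_poly.
Qed.

Lemma poly_vals_submod C d z : is_subring C -> is_submod C (poly_vals C d z).
Proof.
move=> Cr; have [C1 CN CD CM] := Cr; have C0 := subring0 Cr; split.
- by exists 0; rewrite size_poly0 horner0; split=> // i; rewrite coef0.
- move=> _ _ [F [FC sF ->]] [H [HC sH ->]]; exists (F + H); rewrite hornerD; split=> //.
    by move=> i; rewrite coefD; exact: CD.
  by rewrite (leq_trans (size_polyD _ _)) // geq_max sF.
- move=> c _ Cc [F [FC sF ->]]; exists (c *: F); rewrite hornerZ; split=> //.
    by move=> i; rewrite coefZ; exact: CM.
  exact: leq_trans (size_scale_leq _ _) sF.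
Qed.

Lemma noeth_poly_vals C d z : is_subring C -> noeth C C -> noeth C (poly_vals C d z).
Proof.
move=> Cr nC; elim: d => [|d IH].
  move=> N [N0 _ _] N_0; exists [::] => // x /N_0[F [_]].
  by rewrite leqn0 size_poly_eq0 => /eqP -> ->; rewrite horner0; exact: span0.
refine (noeth_sub _ (@noeth_add _ _ (z ^+ d) Cr (poly_vals_submod d z Cr) nC IH)).
by move=> x /(poly_valsS Cr).
Qed.

Lemma adjoin_subring C z : is_subring C -> is_subring (adjoin C z).
Proof.
move=> Cr; have [C1 CN CD CM] := Cr; have C0 := subring0 Cr.
have cst c : C c -> adjoin C z c.
  by move=> Cc; exists c%:P; rewrite ?hornerC // => i; rewrite coefC; case: ifP.
split; [exact: cst|exact: cst| |].
- move=> _ _ [F FC ->] [H HC ->]; exists (F + H); rewrite ?hornerD // => i.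
  by rewrite coefD; exact: CD.
- move=> _ _ [F FC ->] [H HC ->]; exists (F * H); rewrite ?hornerM // => i.
  by rewrite coefM; apply: (submod_sum (subring_submod Cr)) => j _; exact: CM.
Qed.

Lemma sub_adjoin C z : is_subring C -> C `<=` adjoin C z.
Proof.
move=> Cr c Cc; exists c%:P; rewrite ?hornerC // => i.
by rewrite coefC; case: ifP => // _; exact: subring0.
Qed.

Lemma adjoin_gen C z : is_subring C -> adjoin C z z.
Proof.
move=> Cr; exists 'X; rewrite ?hornerX // => i; rewrite coefX.
by case: eqP => _; [case: Cr|exact: subring0].
Qed.

(** The classical argument on leading coefficients, carried out on values [F.[z]] because [z] may
    satisfy relations over [C]. *)
Lemma noeth_adjoin C z : is_subring C -> noeth C C ->
  noeth (adjoin C z) (adjoin C z).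
Proof.
move=> Cr nC J Jm JC.
have [C1 CN CD CM] := Cr; have C0 := subring0 Cr.
have Ar := adjoin_subring z Cr; have CA := @sub_adjoin _ z Cr.
have [J0 JD JM] := Jm.
have JmC : is_submod C J by split=> // c x /CA; exact: JM.
(* The coefficient [c] in degree [d] may be zero, so sums and multiples need no case distinction. *)
pose top d c (F : {poly E}) :=
  [/\ forall i, C F`_i, (size F <= d.+1)%N, F`_d = c & J F.[z]].
have topS k d c F : top d c F -> top (d + k)%N c (F * 'X^k).
  move=> [FC sF Fd JF]; split.
  - by move=> i; rewrite coefMXn; case: ifP.
  - by rewrite (leq_trans (size_polyMleq _ _)) // size_polyXn addnS /= -addSn leq_add2r.
  - by rewrite coefMXn ltnNge leq_addl addnK.
  - rewrite hornerM mulrC; apply: JM => //; exists 'X^k => // i.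
    by rewrite coefXn; case: eqP.
have topD d c c' F F' : top d c F -> top d c' F' -> top d (c + c') (F + F').
  move=> [FC sF Fd JF] [FC' sF' Fd' JF']; split.
  - by move=> i; rewrite coefD; exact: CD.
  - by rewrite (leq_trans (size_polyD _ _)) // geq_max sF.
  - by rewrite coefD Fd Fd'.
  - by rewrite hornerD; exact: JD.
have topZ d c e F : C e -> top d c F -> top d (e * c) (e *: F).
  move=> Ce [FC sF Fd JF]; split.
  - by move=> i; rewrite coefZ; exact: CM.
  - exact: leq_trans (size_scale_leq _ _) sF.
  - by rewrite coefZ Fd.
  - by rewrite hornerZ; apply: JM => //; exact: CA.
pose L : set E := [set c | exists d F, top d c F].
have Lm : is_submod C L.
  split.
  - exists 0%N, 0; split; rewrite ?size_poly0 ?coef0 ?horner0 //.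
    by move=> i; rewrite coef0.
  - move=> c c' [d [F tF]] [d' [F' tF']]; exists (d + d')%N, (F * 'X^d' + F' * 'X^d).
    by apply: topD; [|rewrite addnC]; exact: topS.
  - by move=> c e Cc [d [F tF]]; exists d, (c *: F); exact: topZ.
have [s sL Ls] : exists2 s : seq E, [set` s] `<=` L & L `<=` lspan C [set` s].
  by apply: nC => // c [d [F [FC _ <- _]]].
(* Multiplying by powers of the variable brings the polynomials realizing the generators of [L] to
   one common degree [D]. *)
have [D sD] : exists D, forall c, c \in s -> exists F, top D c F.
  elim: s sL {Ls} => [|c s IH] sL; first by exists 0%N.
  have [e es|D1 IH1] := IH; first by apply: sL; rewrite /= inE es orbT.
  have [D2 [F tF]] := sL c (mem_head _ _).
  exists (D1 + D2)%N => e; rewrite inE => /orP[/eqP ->|/IH1[F' tF']].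
    by exists (F * 'X^D1); rewrite addnC; exact: topS.
  by exists (F' * 'X^D2); exact: topS.
have [g gP] : exists g : E -> {poly E}, forall c, c \in s -> top D c (g c).
  have : forall c, exists F, c \in s -> top D c F.
    by move=> c; case: (boolP (c \in s)) => [/sD[F]|]; [exists F|exists 0].
  by move=> /choice[g gP]; exists g.
(* Elements of [J] of degree less than [D] are handled by a Noetherian [C]-module. *)
have [t tJ Jt] : exists2 t : seq E, [set` t] `<=` J `&` poly_vals C D z
    & J `&` poly_vals C D z `<=` lspan C [set` t].
  apply: (@noeth_poly_vals C D z Cr nC (J `&` poly_vals C D z)) => [|x []//].
  exact: submodI JmC (poly_vals_submod D z Cr).
pose T := t ++ [seq (g c).[z] | c <- s].
exists T => [x|].
  by rewrite /= mem_cat => /orP[/tJ[]//|/mapP[c /gP[_ _ _ ?] ->]].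
have Tm := span_submod [set` T] Ar; have [T0 TD TM] := Tm.
have sT c : lspan C [set` s] c -> exists2 F, top D c F & lspan (adjoin C z) [set` T] F.[z].
  elim=> [|d e y Cd se _ [F tF TF]].
    exists 0; rewrite ?horner0 //; split; rewrite ?size_poly0 ?coef0 ?horner0 //.
    by move=> i; rewrite coef0.
  exists (d *: g e + F); first by apply: topD => //; apply: topZ => //; exact: gP.
  rewrite hornerD hornerZ; apply: TD => //; apply: TM; first exact: CA.
  by apply: span_in => //=; rewrite mem_cat; apply/orP; right; apply/mapP; exists e.
(* From degree [D] on, a combination of the [g c] shifted by a power of the variable cancels the top
   coefficient and lowers the degree. *)
have main d : forall F : {poly E}, (forall i, C F`_i) -> (size F <= d)%N -> J F.[z] ->
    lspan (adjoin C z) [set` T] F.[z].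
  elim: d => [|d IH] F FC sF JF.
    by move: sF; rewrite leqn0 size_poly_eq0 => /eqP ->; rewrite horner0.
  have [dD|Dd] := ltnP d D.
    have : lspan C [set` t] F.[z].
      by apply: Jt; split=> //; exists F; split=> //; exact: leq_trans dD.
    apply: span_min; first by split=> // c x /CA; exact: TM.
    by move=> y ty; apply: span_in => //=; rewrite mem_cat ty.
  have [|G tG TG] := sT F`_d; first by apply: Ls; exists d, F.
  have := topS (d - D)%N _ _ _ tG; rewrite subnKC // => -[GC sG Gd JG].
  rewrite -[F](subrK (G * 'X^(d - D))) hornerD; apply: TD; last first.
    rewrite hornerM mulrC; apply: TM => //; exists 'X^(d - D) => // i.
    by rewrite coefXn; case: eqP.
  have FG : forall i, C (F - G * 'X^(d - D))`_i.
    by move=> i; rewrite coefB; apply: CD => //; apply: subringN.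
  apply: IH => //; last by rewrite hornerD hornerN; exact: (submodB Cr JmC).
  apply/leq_sizeP => j dj; rewrite coefB.
  move: dj; rewrite leq_eqVlt => /orP[/eqP <-|dj]; first by rewrite Gd subrr.
  by rewrite (leq_sizeP _ _ sF) // (leq_sizeP _ _ sG) // subrr.
by move=> x Jx; have [F FC xE] := JC _ Jx; rewrite xE; apply: (main (size F)); rewrite -?xE.
Qed.

Definition adjoins C (s : seq E) := foldr (fun z D => adjoin D z) C s.

Lemma adjoins_subring C s : is_subring C -> is_subring (adjoins C s).
Proof. by move=> Cr; elim: s => //= z s; exact: adjoin_subring. Qed.

Lemma noeth_adjoins C s : is_subring C -> noeth C C ->
  noeth (adjoins C s) (adjoins C s).
Proof.
move=> Cr nC; elim: s => //= z s; apply: noeth_adjoin.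
exact: adjoins_subring.
Qed.

Lemma sub_adjoins C s : is_subring C -> C `<=` adjoins C s.
Proof.
move=> Cr; elim: s => //= z s IH; apply: subset_trans IH _.
exact/sub_adjoin/adjoins_subring.
Qed.

Lemma adjoins_gen C s : is_subring C -> [set` s] `<=` adjoins C s.
Proof.
move=> Cr; elim: s => //= z s IH x /=; rewrite inE => /orP[/eqP ->|/IH].
  exact/adjoin_gen/adjoins_subring.
exact/sub_adjoin/adjoins_subring.
Qed.

Lemma adjoins_min C s T : is_subring T -> C `<=` T -> [set` s] `<=` T ->
  adjoins C s `<=` T.
Proof.
move=> Tr CT; have [T1 TN TD TM] := Tr.
elim: s => //= z s IH sT _ [F FC ->].
have Tz : T z by apply: sT; rewrite /= mem_head.
rewrite horner_coef; apply: (submod_sum (subring_submod Tr)) => i _; apply: (TM).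
  by apply: IH (FC i) => y ys; apply: sT; rewrite /= inE ys orbT.
by elim: (val i) => [|k IHk]; rewrite ?expr0 // exprS; exact: TM.
Qed.

End Noetherian.

(** * Associated primes *)

Lemma setT_subring (R : comNzRingType) : is_subring [set: R].
Proof. by split. Qed.

Lemma noetherian_gen (R : comNzRingType) (N : set R) :
    noetherian R -> is_submod [set: R] N ->
  exists s : seq R, forall x, N x <-> exists c : nat -> R, x = \sum_(i < size s) c i * s`_i.
Proof.
move=> nR [N0 ND NM].
pose p : {pred R^o} := fun y => `[< N y >].
have pE y : reflect (N y) (y \in p) by exact: asboolP.
have pP : GRing.subsemimod_closed p.
  split; first split; first exact/pE.
  - by move=> u v /pE Nu /pE Nv; apply/pE/ND.
  - by move=> a u /pE Nu; apply/pE/NM.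
pose K := GRing.isSubmodClosed.Build R R^o p pP.
pose pS : submodClosed R^o := HB.pack p K.
by have [s sP] := nR pS; exists s => x; rewrite -(sP x); split=> /pE.
Qed.

Lemma noetherian_noeth (R : comNzRingType) : noetherian R -> noeth [set: R] [set: R].
Proof.
move=> nR N Nm _; have [s sP] := noetherian_gen nR Nm.
exists s => [y /= ys|y Ny].
  apply/(sP y); exists (fun i => (i == index y s)%:R).
  have iy : (index y s < size s)%N by rewrite index_mem.
  rewrite (bigD1 (Ordinal iy)) //= eqxx mul1r nth_index // big1 ?addr0 // => i.
  by rewrite -val_eqE /= => /negPf ->; rewrite mul0r.
have Tr := setT_subring R.
have /sP[c ->] := Ny.
apply: (submod_sum (span_submod _ Tr)) => i _; have [_ _ sM] := span_submod [set` s] Tr.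
by apply: sM => //; apply: span_in => //=; exact: mem_nth.
Qed.

Section Scalars.
Variables (R E : comNzRingType) (rho : {rmorphism R -> E}).
Implicit Types (C N : set E) (P : prime_idealr R).

Lemma range_subring : is_subring (range rho).
Proof.
split.
- by exists 1; rewrite ?rmorph1.
- by exists (-1); rewrite ?rmorphN1.
- by move=> _ _ [a _ <-] [b _ <-]; exists (a + b); rewrite ?rmorphD.
- by move=> _ _ [a _ <-] [b _ <-]; exists (a * b); rewrite ?rmorphM.
Qed.

Lemma noeth_range : noetherian R -> noeth (range rho) (range rho).
Proof.
move=> /noetherian_noeth nR N [N0 ND NM] NR.
have [||s sN Ns] := nR (rho @^-1` N) => //.
  split=> /= [|x y Nx Ny|c x _ Nx]; first by rewrite rmorph0.
    by rewrite rmorphD; exact: ND.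
  by rewrite rmorphM; apply: NM => //; exists c.
exists (map rho s) => [_ /mapP[x /sN Nx ->] //|y Ny].
have [x _ xy] := NR _ Ny; rewrite -xy in Ny *.
elim: (Ns _ Ny) => [|c u z _ su _ IH]; first by rewrite rmorph0; exact: span0.
rewrite rmorphD rmorphM; apply: spanD => //=; first by exists c.
by apply/mapP; exists u.
Qed.

(* [P] is an associated prime of the [R]-module [C / N]. *)
Definition assoc C N P := exists2 x, C x & forall r, r \in P <-> N (rho r * x).

(** Noetherian induction on [N]: in a maximal counterexample [M], adding an [x] whose annihilator
    modulo [M] is maximal loses at most one associated prime, the contraction of that
    annihilator. *)
Lemma finite_assoc C N :
    is_subring C -> noeth C C -> (forall r, C (rho r)) -> is_submod C N -> N `<=` C ->
  exists (m : nat) (q : nat -> set R), forall P, assoc C N P ->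
    exists2 i, (i < m)%N & forall r, r \in P <-> q i r.
Proof.
move=> Cr nC CR Nm NC; apply: contrapT => nfin.
pose F : set (set E) := [set N | [/\ is_submod C N, N `<=` C &
  ~ exists (m : nat) (q : nat -> set R),
  forall P, assoc C N P -> exists2 i, (i < m)%N & forall r, r \in P <-> q i r]].
have {nfin Nm NC} FN : F N by [].
have [M [Mm MC infM] Mmax] : exists2 M, F M & forall M', F M' -> M `<=` M' -> M' `<=` M.
  by apply: noeth_max Cr (subring_submod Cr) nC FN _ => N' [].
have [C1 CN CD CM] := Cr; have C0 := subring0 Cr; have [M0 MD MM] := Mm.
have [x0 Cx0 Mx0] : exists2 x, C x & ~ M x.
  apply: contrapT => MT; apply: infM; exists 0%N, (fun=> set0) => P [x Cx Px]; exfalso.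
  suff : 1 \in P by rewrite idealr1.
  apply/Px; rewrite rmorph1 mul1r; apply: contrapT => nMx; apply: MT; by exists x.
pose D x : set E := [set c | C c /\ M (c * x)].
pose G : set (set E) := [set X | exists2 x, C x /\ ~ M x & X = D x].
have [_ [x [Cx Mx] ->] Dmax] : exists2 X, G X & forall X', G X' -> X `<=` X' -> X' `<=` X.
  apply: (@noeth_max _ C C G (D x0)) => //; first by exists x0.
  move=> _ [x _ ->]; split; last by move=> c [].
  split; first by rewrite /D; split=> //; rewrite mul0r.
  - by move=> c d [Cc Mc] [Cd Md]; split; [exact: CD|rewrite mulrDl; exact: MD].
  - by move=> c d Cc [Cd Md]; split; [exact: CM|rewrite -mulrA; exact: MM].
(* A maximal annihilator of a nonzero class is prime: [D (d * x)] contains [D x], so the two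
   agree. *)
have Dprime c d : C c -> C d -> M (c * d * x) -> ~ M (d * x) -> M (c * x).
  move=> Cc Cd Mcd Md; have [|||_ //] := Dmax (D (d * x)) _ _ c.
  - by exists (d * x) => //; split=> //; exact: CM.
  - by move=> e [Ce Me]; split=> //; rewrite mulrCA; exact: MM.
  - by split=> //; rewrite mulrA.
pose M' : set E := [set z | exists m c, [/\ M m, C c & z = m + c * x]].
have MM' : M `<=` M' by move=> m Mm'; exists m, 0; rewrite mul0r addr0.
have M'm : is_submod C M'.
  split; first exact: MM'.
  - move=> _ _ [m [c [Mm1 Cc ->]]] [n [d [Mn Cd ->]]]; exists (m + n), (c + d).
    by split; [exact: MD|exact: CD|rewrite mulrDl addrACA].
  - move=> e _ Ce [m [c [Mm1 Cc ->]]]; exists (e * m), (e * c).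
    by split; [exact: MM|exact: CM|rewrite mulrDr mulrA].
have M'C : M' `<=` C by move=> _ [m [c [/MC Cm Cc ->]]]; apply: CD => //; exact: CM.
have [m [q qP]] : exists (m : nat) (q : nat -> set R),
    forall P, assoc C M' P -> exists2 i, (i < m)%N & forall r, r \in P <-> q i r.
  apply: contrapT => infM'; apply: Mx; apply: (Mmax M') => //.
  by exists 0, 1; rewrite mul1r add0r.
apply: infM; exists m.+1, (fun i => if (i < m)%N then q i else [set r | M (rho r * x)]).
move=> P [z Cz Pz].
(* If some multiple of [z] falls into [M'] but not into [M], it is a nonzero multiple of [x] modulo
   [M], and [P] is the contraction of [D x]. Otherwise [z] has the same annihilator modulo [M']. *)
have [[r M'rz Mrz]|nor] := pselect (exists2 r, M' (rho r * z) & ~ M (rho r * z)).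
  exists m => //; rewrite ltnn => s /=.
  have [n [c [Mn Cc rzE]]] := M'rz.
  have Mcx : ~ M (c * x) by move=> Mcx; apply: Mrz; rewrite rzE; exact: MD.
  have rP : r \notin P by apply/negP => /Pz.
  have -> : s \in P <-> s * r \in P by rewrite prime_idealrM (negPf rP) orbF.
  rewrite Pz rmorphM -mulrA rzE mulrDr mulrA.
  have Msn : M (rho s * n) by exact: MM.
  split=> [Ms|Msx].
    have {}Ms : M (rho s * c * x).
      by rewrite -(addKr (rho s * n) (_ * x)) addrC; exact: (submodB Cr Mm).
    exact: Dprime Ms Mcx.
  by apply: MD => //; rewrite mulrAC mulrC; exact: MM.
have [|i im iP] := qP P.
  exists z => // r; rewrite Pz; split=> [/MM'//|M'r].
  by apply: contrapT => nMr; apply: nor; exists r.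
by exists i => [|r]; [exact: ltnW|rewrite iP im].
Qed.

(* [P] is a minimal prime over the annihilator of [y] in [(E / N)_P]: choose
   the annihilator of [t y] maximal among those contained in [P]. *)
Lemma assoc_local N P y :
    noetherian R -> is_submod (range rho) N ->
    (forall r, N (rho r * y) -> r \in P) ->
    (forall p, p \in P -> exists u k, u \notin P /\ N (rho (u * p ^+ k) * y)) ->
  exists t, forall r, r \in P <-> N (rho (r * t) * y).
Proof.
move=> nR [N0 ND NM] yP Pnil.
have NR r z : N z -> N (rho r * z) by move=> Nz; apply: NM => //; exists r.
have NRM r s z : N (rho s * z) -> N (rho (r * s) * z).
  by rewrite rmorphM -mulrA; exact: NR.
pose D t : set R := [set r | N (rho (r * t) * y)].
pose F : set (set R) := [set X | exists2 t, D t `<=` [set r | r \in P] & X = D t].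
have [_ [t tP ->] tmax] : exists2 X, F X & forall X', F X' -> X `<=` X' -> X' `<=` X.
  apply: (noeth_max (setT_subring R) _ (noetherian_noeth nR) (N0 := D 1)) => [|/=|].
  - exact/subring_submod/setT_subring.
  - by exists 1 => // r; rewrite /D /= mulr1; exact: yP.
  - move=> _ [t _ ->]; split=> //; rewrite /D; split=> /=.
    + by rewrite mul0r rmorph0 mul0r.
    + by move=> r s; rewrite mulrDl rmorphD mulrDl; exact: ND.
    + by move=> c r _; rewrite -mulrA; exact: NRM.
exists t => r; split; last exact: tP.
(* If some [u] outside [P] kills [r * t * y], then [D (u * t)] still lies in [P], so it equals
   [D t], and it contains [r]. *)
move=> rP; have [[u uP Nu]|nou] := pselect (exists2 u, u \notin P & N (rho (u * (r * t)) * y)).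
  apply: (tmax (D (u * t))).
  - exists (u * t) => // s; rewrite /D /= mulrA => /tP /=.
    by rewrite prime_idealrM (negPf uP) orbF.
  - by move=> s; rewrite /D /= mulrCA; exact: NRM.
  - by rewrite /D /= mulrCA.
(* If there is no such [u], then [D (r * t)] lies in [P] and equals [D t] by maximality. This strips
   the factors [r] off [u * r ^+ k] one by one and puts [u] in [P]. *)
have rt : D (r * t) `<=` D t.
  apply: tmax; last by move=> s; rewrite /D /= mulrCA; exact: NRM.
  exists (r * t) => // s Ds; apply: contrapT => /negP sP; apply: nou; by exists s.
have [u [k [uP Nu]]] := Pnil _ rP; case/negP: uP; apply: tP.
have {Nu} : D t (u * r ^+ k) by rewrite /D /= [_ * t]mulrC; exact: NRM.
elim: k => [|k IH]; rewrite ?expr0 ?mulr1 // exprSr mulrA => Dk.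
by apply: IH; apply: rt; rewrite /D /= mulrA.
Qed.

End Scalars.

(** * Powers of an ideal *)

Section Powers.
Variable E : comNzRingType.
Implicit Types (C M N S T : set E) (x y z v w : E) (gs : seq E).

Fixpoint mon gs (k : nat) : set E :=
  if gs is g :: gs' then
    [set x | exists i j y, [/\ k = (i + j)%N, mon gs' j y & x = g ^+ i * y]]
  else [set x | k = 0%N /\ x = 1].

Lemma mon1 gs : mon gs 0 1.
Proof. by elim: gs => [//|g gs IH]; exists 0%N, 0%N, 1; rewrite mulr1. Qed.

Lemma mon0E gs x : mon gs 0 x -> x = 1.
Proof.
elim: gs x => [|g gs IH] x; first by move=> [].
by move=> [[|i] [[|j] [y [// _ /IH -> ->]]]]; rewrite mul1r.
Qed.

Lemma mon_gen gs g : g \in gs -> mon gs 1 g.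
Proof.
elim: gs => [//|h gs IH]; rewrite inE => /orP[/eqP ->|/IH gm].
  by exists 1%N, 0%N, 1; rewrite mulr1; split=> //; exact: mon1.
by exists 0%N, 1%N, g; rewrite mul1r.
Qed.

Lemma monM gs k l x y : mon gs k x -> mon gs l y -> mon gs (k + l) (x * y).
Proof.
elim: gs k l x y => [|g gs IH] k l x y.
  by move=> [-> ->] [-> ->]; split=> //; rewrite mulr1.
move=> [i [j [z [-> mz ->]]]] [i' [j' [z' [-> mz' ->]]]].
exists (i + i')%N, (j + j')%N, (z * z'); split; first by rewrite addnACA.
  exact: IH.
by rewrite exprD mulrACA.
Qed.

Lemma mon_pred gs k x : mon gs k.+1 x ->
  exists g y, [/\ g \in gs, mon gs k y & x = g * y].
Proof.
elim: gs k x => [|g gs IH] k x; first by case.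
move=> [[|i] [j [y [kE my ->]]]].
  move: kE my; rewrite add0n => <- /IH[h [z [hgs mz ->]]].
  exists h, z; rewrite inE hgs orbT mul1r; split=> //.
  by exists 0%N, k, z; rewrite mul1r.
exists g, (g ^+ i * y); rewrite exprS mulrA mem_head; split=> //.
by move: kE => -[->]; exists i, j, y.
Qed.

(* If [gs] is contained in [C], this is the [k]-th power of the ideal of [C]
   generated by [gs]; the elements of [gs] need not lie in [C]. *)
Definition ipow C gs k := lspan C (mon gs k).

Section Ipow.
Variables (C : set E) (gs : seq E).
Hypothesis Cr : is_subring C.

Lemma ipow_submod k : is_submod C (ipow C gs k).
Proof. exact: span_submod. Qed.

Lemma mon_ipow k x : mon gs k x -> ipow C gs k x.
Proof. exact: span_in. Qed.

Lemma ipowM k l x y : ipow C gs k x -> ipow C gs l y -> ipow C gs (k + l) (x * y).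
Proof.
have [P0 PD PM] := ipow_submod (k + l).
move=> + ly; elim=> [|c z x' Cc mz _ IH]; first by rewrite mul0r.
rewrite mulrDl; apply: (PD) => //; rewrite -mulrA; apply: (PM) => //.
elim: ly => [|d w y' Cd mw _ IHy]; first by rewrite mulr0.
rewrite mulrDr; apply: PD => //; rewrite mulrCA; apply: PM => //.
exact/mon_ipow/monM.
Qed.

Lemma ipow0 x : C x -> ipow C gs 0 x.
Proof.
move=> Cx; have [_ _ PM] := ipow_submod 0; rewrite -[x]mulr1; apply: PM => //.
exact/mon_ipow/mon1.
Qed.

Lemma ipowX k l x : ipow C gs k x -> ipow C gs (k * l) (x ^+ l).
Proof.
have [C1 _ _ _] := Cr.
move=> kx; elim: l => [|l IH]; first by rewrite muln0 expr0; exact: ipow0.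
by rewrite mulnS exprS; exact: ipowM.
Qed.

Hypothesis gC : [set` gs] `<=` C.

Lemma ipow_le k l : (l <= k)%N -> ipow C gs k `<=` ipow C gs l.
Proof.
move=> lk; rewrite -(subnKC lk); elim: (k - l)%N => [|d IH]; first by rewrite addn0.
rewrite addnS; apply: subset_trans IH; apply: span_min; first exact: ipow_submod.
move=> x /mon_pred[c [y [/gC Cc my ->]]].
by have [_ _ PM] := ipow_submod (l + d); apply: PM => //; exact: mon_ipow.
Qed.

Lemma ipow_sub k : ipow C gs k `<=` C.
Proof.
apply: span_min; first exact: subring_submod.
have [C1 _ _ CM] := Cr.
elim: k => [|k IH] x; last by move=> /mon_pred[c [y [/gC Cc /IH Cy ->]]]; exact: CM.
by move=> /mon0E ->.
Qed.

End Ipow.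

(** Multiplied by [w ^+ (k - u)], the equation expresses [w ^+ k] through lower powers, so strong
    induction applies. *)
Lemma integral_pow_filtration C (H : nat -> set E) (a : nat -> E) u w :
    is_subring C -> (forall k, is_submod C (H k)) -> (0 < u)%N ->
    w ^+ u + \sum_(1 <= i < u.+1) a i * w ^+ (u - i) = 0 ->
    (forall i k x, (1 <= i <= u)%N -> H k x -> H (i + k)%N (a i * x)) ->
    (forall k, (k < u)%N -> H k (w ^+ k)) ->
  forall k, H k (w ^+ k).
Proof.
move=> Cr Hm u0 wE aH Hw k; elim/ltn_ind: k => k IH.
have [/Hw //|uk] := ltnP k u.
have -> : w ^+ k = - \sum_(1 <= i < u.+1) a i * w ^+ (k - i).
  apply/eqP; rewrite -addr_eq0 -{1}(subnK uk) exprD.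
  rewrite [X in _ + X](_ : _ = w ^+ (k - u) * \sum_(1 <= i < u.+1) a i * w ^+ (u - i)).
    by rewrite -mulrDr wE mulr0.
  rewrite mulr_sumr; apply: eq_big_nat => i /andP[_ iu].
  by rewrite mulrCA -exprD addnC addnBAC // subnKC.
apply: (submodN Cr (Hm k)); rewrite big_nat_cond; apply: (submod_sum (Hm k)) => i.
rewrite andbT => /andP[i1 iu]; have ik : (i <= k)%N by apply: leq_trans uk.
rewrite -{1}(subnKC ik); apply: aH; first by rewrite i1.
by apply: IH; rewrite -{2}(subn0 k) ltn_sub2l // (leq_trans u0).
Qed.

(** * Polynomials in one element with coefficients in powers of an ideal *)

Section PolyFiltration.
Variables (C : set E) (gs : seq E) (x : E).
Hypotheses (Cr : is_subring C) (gC : [set` gs] `<=` C).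

(** Here [m] bounds the degree in [x] and [k] the order along the ideal of [gs]; what matters below
    are bounds [m] that do not grow with [k]. *)
Definition pfil m k : set E := [set y | exists F : {poly E},
  [/\ forall i, ipow C gs k F`_i, (size F <= m.+1)%N & y = F.[x]]].

Lemma pfil_submod m k : is_submod C (pfil m k).
Proof.
have [P0 PD PM] := ipow_submod gs Cr k; split.
- by exists 0; rewrite size_poly0 horner0; split=> // i; rewrite coef0.
- move=> _ _ [F [FC sF ->]] [H [HC sH ->]]; exists (F + H); rewrite hornerD; split=> //.
    by move=> i; rewrite coefD; exact: PD.
  by rewrite (leq_trans (size_polyD _ _)) // geq_max sF.
- move=> c _ Cc [F [FC sF ->]]; exists (c *: F); rewrite hornerZ; split=> //.
    by move=> i; rewrite coefZ; exact: PM.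
  exact: leq_trans (size_scale_leq _ _) sF.
Qed.

Lemma pfilM m k m' k' y z : pfil m k y -> pfil m' k' z -> pfil (m + m') (k + k') (y * z).
Proof.
move=> [F [FC sF ->]] [H [HC sH ->]]; exists (F * H); rewrite hornerM; split=> //.
  move=> i; rewrite coefM; apply: (submod_sum (ipow_submod gs Cr _)) => j _; exact: ipowM.
rewrite (leq_trans (size_polyMleq _ _)) //.
by rewrite -subn1 leq_subLR (leq_trans (leq_add sF sH)) // addSn addnS.
Qed.

Lemma pfil_cst k y : ipow C gs k y -> pfil 0 k y.
Proof.
have [P0 _ _] := ipow_submod gs Cr k.
move=> ky; exists y%:P; rewrite hornerC; split=> // [i|]; last exact: size_polyC_leq1.
by rewrite coefC; case: ifP.
Qed.

Lemma pfil_le m m' k : (m <= m')%N -> pfil m k `<=` pfil m' k.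
Proof. by move=> mm _ [F [FC sF ->]]; exists F; split=> //; exact: leq_trans sF _. Qed.

Lemma pfil_Xn m k y : ipow C gs k y -> pfil m k (y * x ^+ m).
Proof.
have [P0 _ _] := ipow_submod gs Cr k.
move=> ky; exists (y *: 'X^m); rewrite hornerZ hornerXn; split=> //.
  by move=> i; rewrite coefZ coefXn; case: eqP; rewrite ?mulr1 ?mulr0.
by rewrite (leq_trans (size_scale_leq _ _)) // size_polyXn.
Qed.

(** In a monomial [h ^+ i * y] the factor [(x * h) ^+ i] has degree at most [u] in [x] for every
    [i]. The bounds therefore add up over the list, independently of [k]. *)
Lemma pfil_mon (hs : seq E) :
    (forall h, h \in hs -> exists u, forall k, pfil u k ((x * h) ^+ k)) ->
  exists U, forall k y, mon hs k y -> pfil U k (x ^+ k * y).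
Proof.
elim: hs => [|h hs IH] hsP.
  exists 0%N => k _ [-> ->]; rewrite mulr1; apply/pfil_cst/ipow0 => //.
  by case: Cr.
have [|U UP] := IH; first by move=> h' h'hs; apply: hsP; rewrite inE h'hs orbT.
have [u uP] := hsP h (mem_head _ _).
exists (u + U)%N => _ _ [i [j [y [-> my ->]]]].
by rewrite exprD mulrACA -exprMn; apply: pfilM => //; exact: UP.
Qed.

(* The module [pfil U U.+1] is stable under multiplication by [x], because
   [x ^+ U.+1] times the [U.+1]-st power of the ideal [(gs)] falls back into it. *)
Lemma pfil_stable (U : nat) :
    (forall k y, mon gs k y -> pfil U k (x ^+ k * y)) ->
  forall y k, ipow C gs U.+1 y -> poly_vals C U.+1 x (x ^+ k * y).
Proof.
move=> monU y k iy.
have [_ LD LM] := pfil_submod U U.+1.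
have top z : ipow C gs U.+1 z -> pfil U U.+1 (x ^+ U.+1 * z).
  elim=> [|c w z' Cc mw _ IH]; first by rewrite mulr0; case: (pfil_submod U U.+1).
  by rewrite mulrDr mulrCA; apply: LD => //; apply: LM => //; exact: monU.
have stable z : pfil U U.+1 z -> pfil U U.+1 (x * z).
  move=> [F [FC sF ->]]; rewrite (horner_coef_wide _ sF) big_ord_recr mulrDr /=.
  apply: (LD); last by rewrite mulrCA -exprS mulrC; exact: top.
  rewrite mulr_sumr; apply: (submod_sum (pfil_submod U U.+1)) => i _.
  by rewrite mulrCA -exprS; apply: pfil_le (ltn_ord i) _ (pfil_Xn _ (FC i)).
have : pfil U U.+1 (x ^+ k * y).
  elim: k => [|k IH]; last by rewrite exprS -mulrA; exact: stable.
  by rewrite mul1r; apply: pfil_le (leq0n U) _ (pfil_cst iy).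
move=> [F [FC sF ->]]; exists F; split=> // i; exact: (ipow_sub Cr gC) (FC i).
Qed.

(** With [e = U.+1], all [x ^+ k * y] lie in one Noetherian module by [pfil_stable]; their
    dependence is a monic polynomial in [x] killing [y]. *)
Lemma ideal_integral_dep :
    noeth C C -> (forall g, g \in gs -> exists u, forall k, pfil u k ((x * g) ^+ k)) ->
  exists e, forall y, ipow C gs e y ->
    exists K (f : nat -> E), (forall i, C (f i)) /\
      (x ^+ K - \sum_(i < K) f i * x ^+ i) * y = 0.
Proof.
move=> nC /pfil_mon[U /pfil_stable UP]; exists U.+1 => y iy.
have [|K] := noeth_dep Cr (poly_vals_submod U.+1 x Cr)
  (noeth_poly_vals (d := U.+1) (z := x) Cr nC)
  (y := fun k => x ^+ k * y).
  by move=> i; exact: UP.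
move=> /(span_family Cr)[f fC E']; exists K, f; split=> //.
rewrite mulrBl E' mulr_suml; apply/eqP; rewrite subr_eq0; apply/eqP.
by apply: eq_bigr => i _; rewrite mulrA.
Qed.

End PolyFiltration.

(** * Multiplicative filtrations and Rees rings *)

Section Filtration.
Variables (J : nat -> set E).
Hypotheses (Jm : forall k, is_submod [set: E] (J k))
  (JM : forall k l x y, J k x -> J l y -> J (k + l)%N (x * y))
  (J1 : J 0%N 1) (Jle : forall k l, (l <= k)%N -> J k `<=` J l).

(* The Rees ring of [J] inside [E[X]]; its quotient by [rees_ideal] is the
   associated graded ring. *)
Definition rees : set {poly E} := [set F | forall i, J i F`_i].

Lemma filtrationN k x : J k x -> J k (- x).
Proof. by move=> Jx; exact: (submodN (setT_subring E) (Jm k)). Qed.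

Lemma rees_subring : is_subring rees.
Proof.
have J0 i : J i 0 by have [] := Jm i.
have r1 : rees 1 by move=> i; rewrite coef1; case: i => [|i] /=.
split=> //.
- by move=> i; rewrite coefN; exact/filtrationN/r1.
- by move=> F H FJ HJ i; rewrite coefD; have [_ JD _] := Jm i; exact: JD.
- move=> F H FJ HJ i; rewrite coefM; apply: (submod_sum (Jm i)) => j _.
  by rewrite -{1}(subnKC (leq_ord j)); exact: JM.
Qed.

Definition rees_ideal : set {poly E} := [set F | forall i, J i.+1 F`_i].

Lemma rees_ideal_submod : is_submod rees rees_ideal.
Proof.
split.
- by move=> i; rewrite coef0; have [] := Jm i.+1.
- by move=> F H FJ HJ i; rewrite coefD; have [_ JD _] := Jm i.+1; exact: JD.
- move=> F H FJ HJ i; rewrite coefM; apply: (submod_sum (Jm i.+1)) => j _.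
  by rewrite -{1}(subnKC (leq_ord j)) -addnS; exact: JM.
Qed.

Lemma rees_ideal_sub : rees_ideal `<=` rees.
Proof. by move=> F FJ i; exact: (Jle (leqnSn i)). Qed.

(** In each term of the binomial expansion the losses [u] and [u'] at worst add up, thanks to
    truncated subtraction. *)
Lemma pow_filtration_add n u u' z z' :
    (forall k, J (n * (k - u))%N (z ^+ k)) -> (forall k, J (n * (k - u'))%N (z' ^+ k)) ->
  forall k, J (n * (k - (u + u')))%N ((z + z') ^+ k).
Proof.
move=> zJ z'J k; rewrite exprDn; apply: (submod_sum (Jm _)) => i _.
rewrite -mulr_natl; have [_ _ JZ] := Jm (n * (k - (u + u'))).
apply: JZ => //; have le : (n * (k - (u + u')) <= n * (k - i - u) + n * (i - u'))%N.
  rewrite -mulnDr leq_mul2l; apply/orP; right.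
  rewrite leq_subLR addnACA -{1}(subnK (ltn_ord i : (i <= k)%N)).
  by apply: leq_add; rewrite -leq_subLR.
by apply: (Jle le); exact: JM.
Qed.

End Filtration.
End Powers.

(** * Graded algebras *)

Lemma span_monol (E : comNzRingType) (C D S : set E) :
  C `<=` D -> lspan C S `<=` lspan D S.
Proof. by move=> CD x; elim=> [|c y z /CD Dc Sy _ Dz]; [exact: span0|exact: spanD]. Qed.

Section Graded.
Variables (R : comNzRingType) (B : comAlgType R) (G : grading B).
Implicit Types (gs : seq B) (F H : {poly B}).

Let K : set B := range (in_alg B).

(* Homogeneous decompositions are encoded as polynomials evaluated at [1]. *)
Definition homog F := forall i, F`_i \in G i.

Lemma horner1 F m : (size F <= m)%N -> F.[1] = \sum_(i < m) F`_i.
Proof.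
by move=> sF; rewrite (horner_coef_wide _ sF); apply: eq_bigr => i _; rewrite expr1n mulr1.
Qed.

Lemma homog_eq0 F : homog F -> F.[1] = 0 -> F = 0.
Proof.
move=> FG F0; apply/polyP => i; rewrite coef0.
have [iF|/(leq_sizeP _ _)->//] := ltnP i (size F).
by apply: (piece_indep FG) iF; rewrite -(horner1 (leqnn _)).
Qed.

Lemma homogD F H : homog F -> homog H -> homog (F + H).
Proof. by move=> FG HG i; rewrite coefD rpredD. Qed.

Lemma homogB F H : homog F -> homog H -> homog (F - H).
Proof. by move=> FG HG i; rewrite coefB rpredD // -scaleN1r rpredZ. Qed.

Lemma homogM F H : homog F -> homog H -> homog (F * H).
Proof.
move=> FG HG i; rewrite coefM; apply: rpred_sum => j _.
by have := piece_mul (FG j) (HG (i - j)%N); rewrite subnKC ?leq_ord.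
Qed.

Lemma homog_monomial x d : x \in G d -> homog (x *: 'X^d).
Proof.
move=> xG i; rewrite coefZ coefXn.
by case: eqP => [->|_]; rewrite ?mulr1 ?mulr0 ?rpred0.
Qed.

Lemma homog_decomp x : exists2 F, homog F & x = F.[1].
Proof.
have [m [f [fG ->]]] := piece_span G x; exists (\poly_(i < m) f i).
  by move=> i; rewrite coef_poly; case: ifP; rewrite ?rpred0.
rewrite (horner1 (size_poly _ _)); apply: eq_bigr => i _.
by rewrite coef_poly ltn_ord.
Qed.

(** Take components of degree [d n] in the relation: of each [f i] only the component of degree
    [d n - d i] survives, a genuine difference by the bound on [d i]. *)
Lemma homog_dep n (d : nat -> nat) (y f : nat -> B) (F : nat -> {poly B}) :
    (forall i, y i \in G (d i)) -> (forall i, (i < n)%N -> (d i <= d n)%N) ->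
    (forall i, (i < n)%N -> homog (F i) /\ f i = (F i).[1]) ->
    y n = \sum_(i < n) f i * y i ->
  y n = \sum_(i < n) (F i)`_(d n - d i) * y i.
Proof.
move=> yG dn FP yE.
pose H := y n *: 'X^(d n) - \sum_(i < n) F i * (y i *: 'X^(d i)).
have H0 : H = 0.
  apply: homog_eq0.
    apply: homogB; first exact: homog_monomial.
    move=> j; rewrite coef_sum; apply: rpred_sum => i _.
    by apply: homogM; [have [] := FP i (ltn_ord i)|exact: homog_monomial].
  rewrite /H hornerD hornerN hornerZ hornerXn expr1n mulr1 horner_sum yE.
  rewrite -sumrB big1 // => i _; apply/eqP; rewrite subr_eq0; apply/eqP.
  by rewrite hornerM hornerZ hornerXn expr1n mulr1; have [_ ->] := FP i (ltn_ord i).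
have : H`_(d n) = 0 by rewrite H0 coef0.
rewrite /H coefB coefZ coefXn eqxx mulr1 coef_sum => /eqP; rewrite subr_eq0 => /eqP ->.
apply: eq_bigr => i _.
by rewrite -scalerAr coefZ coefMXn ltnNge dn //= mulrC.
Qed.

Lemma in_alg_subring : is_subring K.
Proof. exact: range_subring. Qed.

Lemma piece_submod d : is_submod K [set` G d].
Proof.
split=> /= [|x y|_ x [a _ <-]]; rewrite ?rpred0 //; first exact: rpredD.
by rewrite mulr_algl; exact: rpredZ.
Qed.

(** This carries Hilbert's basis theorem over to generated subalgebras. *)
Lemma gen_subalg_adjoins gs : gen_subalg [set` gs] = adjoins K gs.
Proof.
have Kr := in_alg_subring; have Ar := adjoins_subring gs Kr; have [A1 _ AD AM] := Ar.
apply/seteqP; split.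
  apply: gen_subalg_ind => //; last exact: adjoins_gen.
  move=> a u v Au Av; apply: (AD) => //; rewrite -mulr_algl; apply: AM => //.
  by apply: (sub_adjoins gs Kr); exists a.
apply: adjoins_min; last exact: gen_subalg_sub.
  split; [exact: gen_subalg1| | |exact: gen_subalgM].
  - by move=> T _; rewrite -scaleN1r rpredZ ?rpred1.
  - by move=> x y; rewrite -[x in x + y]scale1r; exact: gen_subalg_lin.
- by move=> _ [a _ <-] T _; rewrite rpredZ ?rpred1.
Qed.

Lemma ipow_gen_subalg gs k : ipow K gs k `<=` gen_subalg [set` gs].
Proof.
have Kr := in_alg_subring; rewrite gen_subalg_adjoins.
have Ar := adjoins_subring gs Kr.
move=> x /(span_monol (sub_adjoins gs Kr)).
exact: (ipow_sub Ar (adjoins_gen Kr) (k := k)).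
Qed.

(** * Homogeneous pieces of algebras generated in degree one *)

Section Generators.
Variable gs : seq B.
Hypothesis gsG : [set` gs] `<=` [set` G 1%N].

Lemma mon_piece k : mon gs k `<=` [set` G k].
Proof.
elim: gs gsG k => [|g s IH] sG k x; first by move=> [-> ->]; exact: grading1.
move=> [i [j [y [-> my ->]]]]; apply: piece_mul.
  have gG : g \in G 1%N by apply: sG; rewrite /= mem_head.
  by have := gradingX i gG; rewrite mul1n.
by apply: IH my => h hs; apply: sG; rewrite /= inE hs orbT.
Qed.

Lemma ipow_piece k : ipow K gs k `<=` [set` G k].
Proof. by apply: span_min; [exact: piece_submod|exact: mon_piece]. Qed.

Lemma gen_subalg_decomp x : gen_subalg [set` gs] x ->
  exists2 F : {poly B}, forall i, ipow K gs i F`_i & x = F.[1].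
Proof.
have Kr := in_alg_subring; have Pm i := ipow_submod gs Kr i.
apply: (@gen_subalg_ind _ _ _
  [set x | exists2 F : {poly B}, forall i, ipow K gs i F`_i & x = F.[1]]).
- exists 1; rewrite ?hornerC // => i; rewrite coef1; case: i => [|i] /=.
    by apply: ipow0 => //; case: Kr.
  by have [] := Pm i.+1.
- move=> a _ _ [F FP ->] [H HP ->]; exists (a%:A *: F + H).
    move=> i; rewrite coefD coefZ; have [_ PD PM] := Pm i.
    by apply: PD => //; apply: PM => //; exists a.
  by rewrite hornerD hornerZ mulr_algl.
- move=> _ _ [F FP ->] [H HP ->]; exists (F * H); rewrite ?hornerM // => i.
  rewrite coefM; apply: (submod_sum (Pm i)) => j _.
  by rewrite -{1}(subnKC (leq_ord j)); exact: ipowM.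
- move=> g gsg; exists (g *: 'X); rewrite ?hornerZ ?hornerX ?mulr1 // => i.
  rewrite coefZ coefX; case: eqP => [->|_]; rewrite ?mulr1 ?mulr0.
    exact/(mon_ipow Kr)/mon_gen.
  by have [] := Pm i.
Qed.

(** Over [K], [ipow] is the span of the monomials of degree exactly [d]; a homogeneous element
    coincides with its own component of degree [d] in a decomposition into such spans. *)
Lemma gen_subalg_piece d x : gen_subalg [set` gs] x -> x \in G d -> ipow K gs d x.
Proof.
move=> /gen_subalg_decomp[F FP xE] xG.
have FG : homog F by move=> i; exact/ipow_piece/FP.
have : F - x *: 'X^d = 0.
  apply: homog_eq0; first by apply: homogB => //; exact: homog_monomial.
  by rewrite hornerD hornerN hornerZ hornerXn expr1n mulr1 xE subrr.
by move=> /eqP; rewrite subr_eq0 => /eqP E; have := FP d; rewrite E coefZ coefXn eqxx mulr1.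
Qed.

(** A monomial of degree [d] times [c] contributes to degree [d] only through the component of [c]
    of degree zero, which is a scalar. So the part of degree [d] of the [d]-th ideal power comes
    from the subalgebra. *)
Lemma ipow_homog d x : ipow [set: B] gs d x ->
  exists2 F, homog F /\ x = F.[1] & ipow K gs d F`_d.
Proof.
have Kr := in_alg_subring; have [P0 PD PM] := ipow_submod gs Kr d.
elim=> [|c m z _ mm _ [F [FG ->] Fd]].
  by exists 0; [split=> [i|]; rewrite ?coef0 ?horner0 ?rpred0|rewrite coef0].
have [H HG ->] := homog_decomp c.
exists (H * (m *: 'X^d) + F); first split.
- by apply: homogD => //; apply: homogM => //; apply/homog_monomial/mon_piece.
- by rewrite hornerD hornerM hornerZ hornerXn expr1n mulr1.
- rewrite coefD; apply: (PD) => //; rewrite -scalerAr coefZ coefMXn ltnn subnn mulrC.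
  apply: PM; last exact: (mon_ipow Kr).
  by have /piece0[r ->] := HG 0%N; exists r.
Qed.

End Generators.
End Graded.

(** * Integrality and values of monic polynomials *)

Section Integral.
Variables (R : comNzRingType) (B : comAlgType R) (G : grading B) (A : graded_subalg G).

Let iota : {rmorphism subalg_ring A -> B} := val.

Lemma int_closureP n x :
  x \in int_closure A n <-> x \in G n /\ integralOver iota x.
Proof.
split=> [/andP[xG /asboolP/integral_eqn_over] //|[xG /(integral_over_eqn xG) xI]].
by apply/andP; split=> //; apply/asboolP.
Qed.

Lemma int_closureM n d a x : a \in subalg A -> a \in G d ->
  x \in int_closure A n -> a * x \in int_closure A (d + n).
Proof.
move=> aA aG /int_closureP[xG xI]; apply/int_closureP; split; first exact: piece_mul.
apply: integral_mul => //.
have -> : a = iota (exist _ a aA) by [].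
exact: integral_id.
Qed.

Lemma monic_relation n x (f : nat -> B) : (forall i, f i \in subalg A) ->
  exists2 p : {poly subalg_ring A}, p \is monic &
    (map_poly iota p).[x] = x ^+ n - \sum_(i < n) f i * x ^+ i.
Proof.
move=> fA; pose c i : subalg_ring A := exist _ (f i) (fA i).
exists ('X^n - \poly_(i < n) c i).
  rewrite monicE lead_coefDl ?lead_coefXn // size_polyXn size_polyN ltnS.
  exact: size_poly.
rewrite rmorphB rmorphXn /= (map_polyX iota) hornerD hornerN hornerXn; congr (_ - _).
rewrite (@horner_coef_wide _ n); last first.
  by rewrite (leq_trans (size_poly _ _)) // size_poly.
by apply: eq_bigr => i _; rewrite (coef_map iota) coef_poly ltn_ord.
Qed.

(** This multiplicative set contains [0] exactly when [x] is integral over [A]; otherwise some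
    minimal prime of [B] avoids it. *)
Definition monic_vals x : set B :=
  [set y | exists2 p : {poly subalg_ring A}, p \is monic & y = (map_poly iota p).[x]].

Lemma monic_vals_mult x : mult_set (monic_vals x).
Proof.
split; first by exists 1; rewrite ?monic1 // rmorph1 hornerC.
move=> _ _ [p pm ->] [q qm ->]; exists (p * q); rewrite ?rpredM //.
by rewrite rmorphM hornerM.
Qed.

Lemma monic_valsX x : monic_vals x x.
Proof. by exists 'X; rewrite ?monicX // (map_polyX iota) hornerX. Qed.

Lemma monic_vals0 x : monic_vals x 0 -> integralOver iota x.
Proof. by move=> [p pm p0]; exists p => //; rewrite /root -p0. Qed.

End Integral.

(** * Associated primes of the integral closures *)

(** Otherwise the products [u * p ^+ k] form a multiplicative set without [0], and a prime avoiding
    it is contained in [P] but misses [p]. *)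
Lemma minimal_prime_nil (R : comNzRingType) (P : prime_idealr R) p :
  minimal_prime P -> p \in P -> exists u k, u \notin P /\ u * p ^+ k = 0.
Proof.
move=> Pmin pP; apply: contrapT => nou.
pose S : set R := [set x | exists u k, u \notin P /\ x = u * p ^+ k].
have Sm : mult_set S.
  split; first by exists 1, 0%N; rewrite idealr1 mulr1.
  move=> _ _ [u [k [uP ->]]] [v [l [vP ->]]]; exists (u * v), (k + l)%N.
  by rewrite prime_idealrM negb_or uP vP mulrACA exprD.
have [|Q _ QS] := exists_minimal_prime Sm.
  by move=> [u [k [uP E]]]; apply: nou; exists u, k.
have QP : {subset Q <= P}.
  move=> x xQ; apply: contrapT => /negP xP; apply: (QS _ xQ).
  by exists x, 0%N; rewrite mulr1.
apply: (QS p); first exact: Pmin pP.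
by exists 1, 1%N; rewrite idealr1 mul1r.
Qed.

Section Main.
Variables (R : comNzRingType) (B : comAlgType R) (G : grading B) (A : graded_subalg G).
Hypothesis noethR : noetherian R.
Variables gs bs : seq B.
Hypotheses (gsG : [set` gs] `<=` [set` G 1%N])
  (genA : gen_subalg [set` gs] = [set` subalg A])
  (bsG : [set` bs] `<=` [set` G 1%N]) (genB : gen_subalg [set` bs] = [set: B]).

Let K : set B := range (in_alg B).
Let iota : {rmorphism subalg_ring A -> B} := val.
Let Kr : is_subring K := in_alg_subring B.
Let nK : noeth K K.
Proof. exact: noeth_range. Qed.

Let A_gen x : x \in subalg A <-> gen_subalg [set` gs] x.
Proof. by rewrite genA. Qed.

Let AC : is_subring [set` subalg A].
Proof. rewrite -genA gen_subalg_adjoins; exact: adjoins_subring. Qed.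

Let nA : noeth [set` subalg A] [set` subalg A].
Proof. rewrite -genA gen_subalg_adjoins; exact: noeth_adjoins. Qed.

Let gsA : [set` gs] `<=` [set` subalg A].
Proof. by rewrite -genA; exact: gen_subalg_sub. Qed.

Let KA : K `<=` [set` subalg A].
Proof. by move=> _ [a _ <-] /=; rewrite rpredZ ?rpred1. Qed.

(** * From degree [n] to degree [n.+1] *)

Lemma subalg_piece_ipow d x : x \in subalg A -> x \in G d -> ipow K gs d x.
Proof. by move=> /A_gen; exact: gen_subalg_piece. Qed.

Lemma ipow_subalg d x : ipow K gs d x -> x \in subalg A.
Proof. by move=> /(ipow_gen_subalg (k := d)); rewrite A_gen. Qed.

(** The [i]-th coefficient of an integral equation has degree [n.+1 * i], at least [i], so it lies
    in the [i]-th power of the ideal of [gs]. The bound [u] is the degree of that equation. *)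
Lemma int_closure_pfil n x g : g \in gs -> x * g \in int_closure A n.+1 ->
  exists u, forall k, pfil [set` subalg A] gs x u k ((x * g) ^+ k).
Proof.
move=> ggs /andP[_ /asboolP[u [a [u0 aA wE]]]]; exists u.
apply: (integral_pow_filtration AC (fun k => pfil_submod gs x AC u k) u0 wE)
    => [i k y iu Hy|k ku].
  have [aiA aiG] := aA i iu.
  rewrite -[u in pfil _ _ _ u _ _]add0n; apply: pfilM => //; apply: pfil_cst => //.
  have := subalg_piece_ipow aiA aiG => /(span_monol KA).
  by apply: (ipow_le AC gsA); rewrite mulSn leq_addr.
apply: (pfil_le (ltnW ku)); rewrite exprMn mulrC; apply: pfil_Xn => //.
by rewrite -[k in ipow _ _ k]mul1n; apply: ipowX => //; exact/(mon_ipow AC)/mon_gen.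
Qed.

(** Otherwise [ideal_integral_dep], applied to [g ^+ e], gives a monic [p] with [p(x) * g ^+ e = 0];
    as [g] is outside [Q], the value [p(x)] would lie in [Q]. *)
Lemma int_closure_colon n x (Q : prime_idealr B) g :
    (forall y, y \in Q -> ~ monic_vals A x y) -> g \in gs -> g \notin Q ->
  exists2 h, h \in gs & x * h \notin int_closure A n.+1.
Proof.
move=> QS ggs gQ; apply: contrapT => nox.
have [|e eP] := @ideal_integral_dep _ _ gs x AC gsA nA.
  move=> h hgs; apply: (@int_closure_pfil n) => //.
  by apply: contrapT => /negP xh; apply: nox; exists h.
have [|m [f [fA E]]] := eP (g ^+ e).
  by rewrite -[e in ipow _ _ e]mul1n; apply: ipowX => //; exact/(mon_ipow AC)/mon_gen.
have [p pm pE] := @monic_relation _ _ _ A m x f fA.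
have : (map_poly iota p).[x] * g ^+ e \in Q by rewrite pE E idealr0.
rewrite prime_idealrM => /orP[/QS|/prime_idealX]; last by rewrite (negPf gQ).
by apply; exists p.
Qed.

Lemma ipow_prime (Q : prime_idealr B) (s : seq B) d x :
  [set` s] `<=` [set` Q] -> (0 < d)%N -> ipow K s d x -> x \in Q.
Proof.
move=> sQ d0; case: d d0 => // d _; elim=> [|c y z _ my _ zQ]; first exact: idealr0.
have [g [w [/sQ gQ _ ->]]] := mon_pred my.
by rewrite rpredD // idealMr // mulrC idealMr.
Qed.

Lemma Ass_step n (P : prime_idealr R) : (1 <= n)%N ->
    (forall P : prime_idealr B, minimal_prime P ->
       minimal_prime (contraction (in_alg B) P)) ->
    (exists2 x, x \in G n & forall r : R, r \in P <-> r *: x \in int_closure A n) ->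
  exists2 x, x \in G n.+1 & forall r : R, r \in P <-> r *: x \in int_closure A n.+1.
Proof.
move=> n1 contr [x0 x0G x0P].
have clZ m r z : z \in int_closure A m -> r *: z \in int_closure A m by exact: rpredZ.
(* In the first case the annihilator of [x0 * g] is exactly [P], since multiplication by [g]
   preserves integrality. *)
have [good|nogood] := pselect (exists2 g, g \in gs &
    forall r : R, r *: (x0 * g) \in int_closure A n.+1 -> r \in P).
  have [g ggs gP] := good; exists (x0 * g).
    by rewrite -addn1; apply: piece_mul => //; exact: gsG.
  move=> r; split=> [/x0P rx|/gP//].
  rewrite scalerAl mulrC -add1n; apply: int_closureM rx; [exact: gsA|exact: gsG].
(* One scalar for each generator, multiplied together; the product stays outside the prime [P], so
   [u *: x0] has the same annihilator as [x0]. *)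
have [u uP uE] : exists2 u, u \notin P & forall g, g \in gs -> u *: (x0 * g) \in int_closure A n.+1.
  have {nogood} : forall g, g \in gs ->
      exists2 u, u \notin P & u *: (x0 * g) \in int_closure A n.+1.
    move=> g ggs; apply: contrapT => nou; apply: nogood; exists g => // r rx.
    by apply: contrapT => /negP rP; apply: nou; exists r.
  elim: (gs) => [|g s IH] sP; first by exists 1; rewrite ?idealr1.
  have [h hs|u uP us] := IH; first by apply: sP; rewrite inE hs orbT.
  have [v vP vg] := sP g (mem_head _ _).
  exists (u * v) => [|h]; first by rewrite prime_idealrM negb_or uP.
  by rewrite inE => /orP[/eqP ->|/us ux]; [|rewrite mulrC]; rewrite -scalerA clZ.
pose x := u *: x0.
have xG : x \in G n by exact: rpredZ.
have xP r : r \in P <-> r *: x \in int_closure A n.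
  by rewrite /x scalerA -x0P prime_idealrM (negPf uP) orbF.
have xgs g : g \in gs -> x * g \in int_closure A n.+1 by move=> /uE; rewrite /x scalerAl.
have [|Q Qmin QS] := exists_minimal_prime (monic_vals_mult A x).
  move=> /monic_vals0 xI; suff : 1 \in P by rewrite idealr1.
  by apply/xP; rewrite scale1r; apply/int_closureP.
have xQ : x \notin Q by apply/negP => /QS; apply; exact: monic_valsX.
have gsQ : [set` gs] `<=` [set` Q].
  move=> g /= ggs; apply: contrapT => /negP gQ.
  by have [h /xgs ->] := int_closure_colon n QS ggs gQ.
(* The coefficients of an integral equation of [z] have positive degree, hence lie in [Q], and then
   so does a power of [z]. *)
have clQ m z : (0 < m)%N -> z \in int_closure A m -> z \in Q.
  move=> m0 /andP[_ /asboolP[k [a [k0 aA zE]]]].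
  apply: (@prime_idealX _ _ _ k).
  rewrite -[_ ^+ _](addrK (\sum_(1 <= i < k.+1) a i * z ^+ (k - i))) zE.
  rewrite add0r rpredN big_nat_cond; apply: rpred_sum => i; rewrite andbT => ik.
  rewrite mulrC idealMr //; have [aiA aiG] := aA i ik.
  apply: (ipow_prime gsQ _ (subalg_piece_ipow aiA aiG)).
  by case/andP: ik => i1 _; rewrite muln_gt0 m0.
(* If [Q] contained all of [bs], it would contain [x], which has positive degree. *)
have [b bbs bQ] : exists2 b, b \in bs & b \notin Q.
  apply: contrapT => nob; case/negP: xQ.
  apply: (@ipow_prime Q bs n) => //; last by apply: (gen_subalg_piece bsG) xG; rewrite genB.
  by move=> b /= bbs; apply: contrapT => /negP bQ; apply: nob; exists b.
have scQ (r : R) z : z \notin Q -> (r *: z \in Q) = (r \in contraction (in_alg B) Q).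
  by move=> zQ; rewrite -mulr_algl prime_idealrM (negPf zQ) orbF.
have PQ : {subset P <= contraction (in_alg B) Q}.
  by move=> r /xP/(clQ _ _ n1); rewrite scQ.
have QP := contr _ Qmin P PQ.
have Pmin : minimal_prime P.
  move=> P' P'P r rP; apply: (contr _ Qmin P') => [s /P'P /PQ //|]; exact: PQ.
pose y := x * b.
have yG : y \in G n.+1 by rewrite -addn1; apply: piece_mul => //; exact: bsG.
have yQ : y \notin Q by rewrite prime_idealrM negb_or xQ.
have clm : is_submod K [set` int_closure A n.+1].
  split=> /= [|z w|_ z [a _ <-]]; first exact: rpred0; first exact: rpredD.
  by rewrite mulr_algl; exact: clZ.
(* A scalar sending [y] into the integral closure sends it into [Q], hence lies in [P]; elements of
   [P] are nilpotent up to a factor outside [P] because [P] is minimal. *)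
have [||t tP] := @assoc_local _ _ (in_alg B) _ P y noethR clm.
- move=> r /= ; rewrite mulr_algl => /(clQ _ _ (ltn0Sn n)); rewrite scQ //; exact: QP.
- move=> p /(minimal_prime_nil Pmin)[v [k [vP vE]]]; exists v, k; split=> //.
  by rewrite vE rmorph0 mul0r /= rpred0.
exists (t *: y) => [|r]; first exact: rpredZ.
by rewrite tP /= mulr_algl scalerA.
Qed.


(** * Finiteness through the Rees ring *)

Let J : nat -> set B := ipow [set: B] gs.

Let Jm k : is_submod [set: B] (J k).
Proof. exact/ipow_submod/setT_subring. Qed.

Let JM k l x y : J k x -> J l y -> J (k + l)%N (x * y).
Proof. exact/ipowM/setT_subring. Qed.

Let J0 x : J 0%N x.
Proof. by apply: ipow0 => //; exact: setT_subring. Qed.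

Let Jle k l : (l <= k)%N -> J k `<=` J l.
Proof. by apply: ipow_le => //; exact: setT_subring. Qed.

Let JZ k (r : R) x : J k x -> J k (r *: x).
Proof. by move=> Jx; have [_ _ PM] := Jm k; rewrite -mulr_algl; exact: PM. Qed.

Let rho : {rmorphism R -> {poly B}} := polyC \o in_alg B.

Lemma polyC_rees b : rees J b%:P.
Proof. by move=> [|i]; rewrite coefC //=; have [] := Jm i.+1. Qed.

Lemma monomial_rees k x : J k x -> rees J (x *: 'X^k).
Proof.
move=> Jx i; rewrite coefZ coefXn; case: eqP => [->|_]; first by rewrite mulr1.
by rewrite mulr0; have [] := Jm i.
Qed.

(** A monomial of degree [i] in [gs], times ['X^i], is a product of elements [g *: 'X]. Finite
    generation over the image of [R] makes the Rees ring Noetherian. *)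
Lemma rees_adjoins :
  rees J = adjoins (range rho) (map polyC bs ++ [seq g *: 'X | g <- gs]).
Proof.
have Rr : is_subring (range rho) by exact: range_subring.
have Jr := rees_subring Jm JM (J0 1).
set D := adjoins _ _; have Dr : is_subring D by exact: adjoins_subring.
have [D1 DN DD DM] := Dr.
have Dgen := adjoins_gen (s := map polyC bs ++ [seq g *: 'X | g <- gs]) Rr.
apply/seteqP; split; last first.
  apply: adjoins_min => //; first by move=> _ [r _ <-]; exact: polyC_rees.
  move=> F; rewrite /= mem_cat => /orP[/mapP[b _ ->]|/mapP[g ggs ->]].
    exact: polyC_rees.
  rewrite -['X]expr1; apply: monomial_rees; apply: mon_ipow; first exact: setT_subring.
  exact: mon_gen.
have Dcst b : D b%:P.
  have : [set: B] b by []; rewrite -genB.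
  apply: (@gen_subalg_ind _ _ _ [set b | D b%:P]) => //=.
  - move=> a u v Du Dv; rewrite polyCD -mulr_algl polyCM; apply: (DD) => //; apply: DM => //.
    by apply: (sub_adjoins _ Rr); exists a.
  - by move=> u v Du Dv; rewrite polyCM; exact: DM.
  - by move=> c cbs; apply: Dgen; rewrite /= mem_cat map_f.
have Dmon k m : mon gs k m -> D (m *: 'X^k).
  have : forall g, g \in gs -> D (g *: 'X).
    move=> g ggs; apply: Dgen; rewrite /= mem_cat; apply/orP; right.
    by apply/mapP; exists g.
  elim: (gs) k m => [|g s IH] k m sD; first by move=> [-> ->]; rewrite scale1r.
  move=> [i [j [y [-> my ->]]]].
  have -> : (g ^+ i * y) *: 'X^(i + j) = (g *: 'X) ^+ i * (y *: 'X^j) :> {poly B}.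
    by rewrite exprZn -scalerAl -scalerAr scalerA -exprD.
  apply: (DM); last by apply: IH my => h hs; apply: sD; rewrite inE hs orbT.
  have Dg := sD g (mem_head _ _).
  by elim: i => [|i IHi]; rewrite ?expr0 // exprS; exact: DM.
move=> F FJ; rewrite -(coefK F) poly_def; apply: (submod_sum (subring_submod Dr)) => i _.
elim: (FJ i) => [|c m z _ mm _ IH]; first by rewrite scale0r; exact: subring0.
rewrite scalerDl; apply: (DD) => //; rewrite -scalerA -mul_polyC; apply: DM => //.
exact: Dmon.
Qed.

Lemma noeth_rees : noeth (rees J) (rees J).
Proof.
rewrite rees_adjoins; apply: noeth_adjoins; first exact: range_subring.
exact: noeth_range.
Qed.

(** For a single [r] in [P] the loss of order is the degree of the integral equation of [r *: x].
    The losses of finitely many generators of [P] add up to a [U] uniform in [p] and [k]. *)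
Lemma int_closure_powers n (P : prime_idealr R) x :
    (forall r : R, r \in P -> r *: x \in int_closure A n) ->
  exists U, forall p k, p \in P -> J (n * (k - U))%N ((p *: x) ^+ k).
Proof.
move=> xP.
have Pm : is_submod [set: R] [set` P].
  split=> /= [|r s|c r _]; [exact: idealr0|exact: rpredD|exact: idealMr].
have [s sP] := noetherian_gen noethR Pm.
have one r : r \in P -> exists u, forall k, J (n * (k - u))%N ((r *: x) ^+ k).
  move=> /xP /andP[_ /asboolP[u [a [u0 aA wE]]]]; exists u.
  have aJ i : (1 <= i <= u)%N -> J (n * i)%N (a i).
    move=> iu; have [aiA aiG] := aA i iu.
    exact: (span_monol (fun z _ => I)) (subalg_piece_ipow aiA aiG).
  (* Truncated subtraction makes the required order zero for all exponents below [u]. *)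
  apply: (integral_pow_filtration (setT_subring B) (fun k => Jm (n * (k - u))) u0 wE)
    => [i k y iu Hy|k ku].
    apply: Jle (JM (aJ i iu) Hy); rewrite -mulnDr leq_mul2l; apply/orP; right.
    by rewrite leq_subLR addnCA leq_add2l -leq_subLR.
  have /eqP -> : (k - u == 0)%N by rewrite subn_eq0 ltnW.
  by rewrite muln0; exact: J0.
have [U UP] : exists U, forall (c : nat -> R) k,
    J (n * (k - U))%N (((\sum_(i < size s) c i * s`_i) *: x) ^+ k).
  have : forall r, r \in s -> r \in P.
    move=> r rs; apply/sP; exists (fun i => (i == index r s)%:R).
    have ir : (index r s < size s)%N by rewrite index_mem.
    rewrite (bigD1 (Ordinal ir)) //= eqxx mul1r nth_index // big1 ?addr0 // => i.
    by rewrite -val_eqE /= => /negPf ->; rewrite mul0r.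
  elim: (s) => [|r s' IH] sub.
    exists 0%N => c k; rewrite big_ord0 scale0r expr0n; case: eqP => [->|_].
      by rewrite muln0; exact: J0.
    by have [] := Jm (n * (k - 0)).
  have [t ts'|U UP] := IH; first by apply: sub; rewrite inE ts' orbT.
  have [u uP] := one r (sub r (mem_head _ _)).
  exists (u + U)%N => c k; rewrite big_ord_recl /= scalerDl.
  apply: (pow_filtration_add Jm JM Jle) => {}k.
    by rewrite -scalerA exprZn; exact: JZ.
  exact: (UP (fun i => c i.+1)).
by exists U => p k /sP[c ->].
Qed.

(** A dependence among the elements [y k *: 'X^(n * k)] of the Rees ring is cut down twice, first to
    one power of the variable and then to one degree of [B]. The surviving coefficients are in [A]
    by [ipow_homog]. *)
Lemma rees_dep n V (y : nat -> B) :
    (forall k, y k \in G (n * (V + k))%N) -> (forall k, J (n * k)%N (y k)) ->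
  exists m (f : nat -> B), (forall i, f i \in subalg A) /\ y m = \sum_(i < m) f i * y i.
Proof.
move=> yG yJ.
have Jr := rees_subring Jm JM (J0 1).
have [|m] := noeth_dep Jr (subring_submod Jr) noeth_rees (y := fun k => y k *: 'X^(n * k)).
  by move=> i; exact: monomial_rees.
move=> /(span_family Jr)[F FJ yE].
have {}yE : y m = \sum_(i < m) (F i)`_(n * m - n * i) * y i.
  have := congr1 (fun H : {poly B} => H`_(n * m)) yE.
  rewrite /= coefZ coefXn eqxx mulr1 coef_sum => ->; apply: eq_bigr => i _.
  by rewrite -scalerAr coefZ coefMXn ltnNge leq_mul2l (ltnW (ltn_ord i)) orbT /= mulrC.
have hom i : exists H : {poly B}, [/\ homog G H, (F i)`_(n * m - n * i) = H.[1]
    & ipow K gs (n * m - n * i) H`_(n * m - n * i)].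
  by have [H [HG HE] HK] := ipow_homog gsG (FJ i (n * m - n * i)%N); exists H.
have [H HP] := choice hom.
exists m, (fun i => (H i)`_(n * m - n * i)); split.
  by move=> i; have [_ _ /ipow_subalg] := HP i.
rewrite (homog_dep (F := H) (f := fun i => (F i)`_(n * m - n * i)) yG _ _ yE) => [|i im|i im].
- by apply: eq_bigr => i _; rewrite !mulnDr subnDl.
- by rewrite leq_mul2l leq_add2l ltnW ?orbT.
- by have [? ? _] := HP i.
Qed.

Lemma Ass_rees n (P : prime_idealr R) :
    (exists2 x, x \in G n & forall r : R, r \in P <-> r *: x \in int_closure A n) ->
  assoc rho (rees J) (rees_ideal J) P.
Proof.
move=> [x xG xP]; apply: contrapT => nass.
have [U UP] := int_closure_powers (fun r => (xP r).1).
have rhoE r y j : rho r * (y *: 'X^j) = (r%:A * y) *: 'X^j.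
  by rewrite /= mul_polyC scalerA.
(* The order is raised one step at a time: if no factor outside [P] raised it from [j] to [j.+1],
   [assoc_local] would exhibit [P] as the annihilator of a class of order [j] in the associated
   graded ring. *)
have main k j : (j <= n * (k - U))%N -> exists2 s, s \notin P & J j (s *: x ^+ k).
  elim: j => [|j IH] jk; first by exists 1; rewrite ?idealr1.
  have [s sP sJ] := IH (ltnW jk); apply: contrapT => nos.
  have JmK : is_submod (range (in_alg B)) (J j.+1).
    by have [P0 PD PM] := Jm j.+1; split=> // c z _; exact: PM.
  have [||t tP] := @assoc_local _ _ (in_alg B) _ P (s *: x ^+ k) noethR JmK.
  - move=> r /=; rewrite mulr_algl scalerA => rJ; apply: contrapT => /negP rP.
    by apply: nos; exists (r * s); rewrite // prime_idealrM negb_or rP.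
  - move=> p pP; exists 1, k; rewrite idealr1; split=> //=.
    rewrite mul1r mulr_algl scalerA mulrC -scalerA -exprZn.
    by apply/JZ/(Jle jk)/UP.
  apply: nass; exists ((t *: (s *: x ^+ k)) *: 'X^j); first exact/monomial_rees/JZ.
  move=> r; rewrite tP rhoE; set w := t *: _.
  have -> : in_alg B (r * t) * (s *: x ^+ k) = r%:A * w.
    by rewrite /= !mulr_algl -scalerA.
  split=> [rJ i|/(_ j)].
    rewrite coefZ coefXn; case: eqP => [->|_]; first by rewrite mulr1.
    by rewrite mulr0; have [] := Jm i.+1.
  by rewrite coefZ coefXn eqxx mulr1.
(* Exponents [V + k] absorb the loss [U]. The extra unit lets [s m ^+ (V + m)] split as
   [s m ^+ (U + m)] times [s m], even for [m = 0]. *)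
pose V := U.+1.
have step k : exists s, s \notin P /\ J (n * k)%N (s *: x ^+ (V + k)).
  have [|s sP sJ] := main (V + k)%N (n * k)%N; last by exists s.
  by rewrite leq_mul2l leq_subRL ?leq_add2r ?leqnSn ?orbT // (leq_trans _ (leq_addr _ _)).
have [s sP] := choice step.
have [|k|m [f [fA yE]]] := @rees_dep n V (fun k => s k *: x ^+ (V + k)).
- by move=> k; apply: rpredZ; exact: gradingX.
- by case: (sP k).
have [/negP smP _] := sP m; apply: smP; apply/xP; apply/int_closureP.
split; first exact: rpredZ.
(* Multiplying the relation by [s m ^+ (U + m)] gives [z ^+ (V + m)] as the sum of the
   [c i * z ^+ (V + i)]. Of the scalar powers, [s m ^+ (V + i)] goes into [z ^+ (V + i)] and the
   rest into [c i]. *)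
pose z := s m *: x; pose c i := (s m ^+ (m - i.+1) * s i) *: f i.
have [|p pm pE] := @monic_relation _ _ _ A m z c.
  by move=> i; exact: rpredZ.
apply: monic_vals0; exists (p * 'X^V); first by rewrite rpredM ?monicXn.
rewrite rmorphM hornerM /= (map_polyXn iota) hornerXn pE.
apply/esym/eqP; rewrite mulrBl subr_eq0 mulr_suml -exprD; apply/eqP.
transitivity (s m ^+ (U + m) *: (s m *: x ^+ (V + m))).
  by rewrite scalerA -exprSr -addSn exprZn addnC.
rewrite yE scaler_sumr; apply: eq_bigr => i _.
rewrite -mulrA -exprD /c /z exprZn -!scalerAl -!scalerAr !scalerA (addnC i).
congr (_ *: _); rewrite mulrAC -exprD; congr (_ ^+ _ * _).
by rewrite /V addSnnS addnCA subnK.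
Qed.

End Main.

Theorem theorem7p5 (R : comNzRingType) (B : comAlgType R)
    (G : grading B) (A : graded_subalg G)
    (noethR : noetherian R)
    (fgB : fin_gen_alg [set: B])
    (fgA : fin_gen_alg [set` subalg A])
    (stdB : gen_subalg [set` G 1%N] = [set: B])
    (stdA : gen_subalg ([set` subalg A] `&` [set` G 1%N]) = [set` subalg A])
    (contr : forall P : prime_idealr B, minimal_prime P ->
       minimal_prime (contraction (in_alg B) P)) :
  (forall n : nat, (1 <= n)%N ->
     Ass (quot_mod (G n) (int_closure A n))
       `<=` Ass (quot_mod (G n.+1) (int_closure A n.+1))) /\
  (exists N : nat, forall n : nat, (N <= n)%N ->
     Ass (quot_mod (G n) (int_closure A n))
       = Ass (quot_mod (G n.+1) (int_closure A n.+1))).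
Proof.
have [bs bsG genB] := fin_gen_alg_sub fgB stdB.
have [gs gsAG genA] := fin_gen_alg_sub fgA stdA.
have gsG : [set` gs] `<=` [set` G 1%N] by move=> g /gsAG[].
pose T n := Ass (quot_mod (G n) (int_closure A n)).
have step n : (1 <= n)%N -> T n `<=` T n.+1.
  move=> n1 P /Ass_quot_mod PA; apply/Ass_quot_mod.
  exact: (Ass_step noethR gsG genA bsG genB n1 contr PA).
split=> //.
have mono m n : (1 <= m <= n)%N -> T m `<=` T n.
  move=> /andP[m1]; elim: n => [|n IH]; first by rewrite leqn0 => /eqP ->.
  rewrite leq_eqVlt => /orP[/eqP -> //|mn].
  exact: subset_trans (IH mn) (step _ (leq_trans m1 mn)).
(* The associated graded ring does not depend on [n], so one finite list covers the associated
   primes in all degrees. *)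
have [m [q qP]] : exists (m : nat) (q : nat -> set R), forall n P, T n P ->
    exists2 i, (i < m)%N & forall r, r \in P <-> q i r.
  have Jm k : is_submod [set: B] (ipow [set: B] gs k) := ipow_submod _ (setT_subring B) k.
  have JM k l x y : ipow [set: B] gs k x -> ipow [set: B] gs l y ->
      ipow [set: B] gs (k + l)%N (x * y) by apply: ipowM; exact: setT_subring.
  have J1 : ipow [set: B] gs 0 1 by apply: ipow0 => //; exact: setT_subring.
  have [|||||m [q qP]] := @finite_assoc R _ (polyC \o in_alg B)
      (rees (ipow [set: B] gs)) (rees_ideal (ipow [set: B] gs)).
  - exact: rees_subring.
  - exact: (@noeth_rees R B noethR gs bs genB).
  - by move=> r; exact: polyC_rees.
  - exact: rees_ideal_submod.
  - by apply: rees_ideal_sub => k l kl; apply: ipow_le => //; exact: setT_subring.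
  exists m, q => n P /Ass_quot_mod PA; apply: qP.
  exact: (Ass_rees noethR gsG genA genB PA).
(* The list [q] determines a prime only through its elements, so membership in [T n] is shown to
   depend on these alone. *)
have TE n (P P' : prime_idealr R) : (forall r, r \in P <-> r \in P') -> T n P -> T n P'.
  move=> PP' /Ass_quot_mod[x xG xP]; apply/Ass_quot_mod; exists x => // r.
  by rewrite -PP'.
(* For each entry of the list choose a positive degree in which it occurs, or degree one if it never
   occurs. By monotonicity, every prime that ever occurs is present beyond the largest of these
   degrees. *)
have early i : exists n0, (0 < n0)%N /\ forall n P, (0 < n)%N -> T n P ->
    (forall r, r \in P <-> q i r) -> T n0 P.
  have [[n [P [n0 TP Pq]]]|none] := pselect (exists n P,
      [/\ (0 < n)%N, T n P & forall r, r \in P <-> q i r]).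
    by exists n; split=> // k P' _ _ P'q; apply: TE TP => r; rewrite Pq P'q.
  by exists 1%N; split=> // n P n0 TP Pq; case: none; exists n, P.
have [N0 N0P] := choice early.
exists (\max_(i < m) N0 i).+1 => n Nn.
apply/seteqP; split; first by apply: step; exact: leq_trans Nn.
move=> P TP; have [i im iP] := qP _ _ TP; have [N0_gt0 N0T] := N0P i.
apply: (mono (N0 i)); last exact: N0T TP iP.
by rewrite N0_gt0 (leq_trans _ (ltnW Nn)) // (leq_bigmax (Ordinal im)).
Qed.
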